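(* Let $q<0$. If $\varphi$ is a nonzero finite Borel measure on $\mathrm{cl}\,\Omega_{C^\circ}$, then there exists a $C$-pseudo-cone $K\in ps(C)$ with $\widetilde C_q(K,\cdot)=\varphi$.
   Context: Work in $\mathbb{R}^n$, $n\ge 2$, with scalar product $\langle\cdot,\cdot\rangle$, origin $o$ and unit sphere $\mathbb{S}^{n-1}$. Fix a closed convex cone $C\subset\mathbb{R}^n$ with nonempty interior and not containing a line. Its dual cone is $C^\circ:=\{x\in\mathbb{R}^n:\langle x,y\rangle\le 0\ \forall y\in C\}$. Put $\Omega_C:=\mathbb{S}^{n-1}\cap\mathrm{int}\,C$ and $\Omega_{C^\circ}:=\mathbb{S}^{n-1}\cap\mathrm{int}\,C^\circ$; $\mathrm{cl}\,\Omega_{C^\circ}$ is the closure of $\Omega_{C^\circ}$ in $\mathbb{S}^{n-1}$. A $C$-pseudo-cone is a (nonempty) closed convex set $K\subset C$ with $o\notin K$ whose recession cone $\mathrm{rec}\,K=\{z\in\mathbb{R}^n:K+z\subseteq K\}$ equals $C$. The set of all $C$-pseudo-cones is denoted by $ps(C)$. For $K\in ps(C)$: - the radial function is $\rho_K(v):=\min\{r>0:rv\in K\}$ for $v\in\Omega_C$; - an outer unit normal vector of $K$ at a boundary point $x$ is a unit vector $u$ with $\langle y-x,u\rangle\le 0$ for all $y\in K$; - $\eta_K$ is the set of all $v\in\Omega_C$ for which the outer unit normal vector of $K$ at the boundary point $\rho_K(v)v$ is not unique (it has spherical Lebesgue measure zero); - the radial Gauss map $\alpha_K:\Omega_C\setminus\eta_K\to\mathrm{cl}\,\Omega_{C^\circ}$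 sends $v$ to the unique outer unit normal vector of $K$ at $\rho_K(v)v$. For $q<0$ and $K\in ps(C)$, the $q$th dual curvature measure of $K$ is the finite Borel measure on $\mathrm{cl}\,\Omega_{C^\circ}$ given by $$\widetilde C_q(K,\omega):=\frac1n\int_{\alpha_K^{-1}(\omega)}\rho_K(v)^q\,\mathrm{d}v\quad\text{for Borel sets }\omega\subset\mathrm{cl}\,\Omega_{C^\circ},$$ where $\mathrm{d}v$ denotes integration with respect to spherical Lebesgue measure. *)

(* Defs.v *)
From HB Require Import structures.
From mathcomp Require Import all_boot all_order all_algebra.
From mathcomp Require Import all_classical all_reals all_analysis.

Set Implicit Arguments.
Unset Strict Implicit.
Unset Printing Implicit Defensive.

Import Order.TTheory GRing.Theory Num.Theory.
Import numFieldNormedType.Exports.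

Local Open Scope classical_set_scope.
Local Open Scope ring_scope.

(* R^n is 'rV[R]_n.  Its library norm `|x| is the max norm: it gives the right
   topology, but the Euclidean norm is [enorm]. *)
Section euclidean.
Context {R : realType} {n : nat}.
Implicit Types x y u : 'rV[R]_n.

Definition dot x y : R := \sum_(i < n) x ord0 i * y ord0 i.

Definition enorm x : R := Num.sqrt (dot x x).

Definition sphere : set 'rV[R]_n := [set x | enorm x = 1].

Definition sphere_proj x : 'rV[R]_n := (enorm x)^-1 *: x.

End euclidean.

Notation borel R n := (g_sigma_algebraType (@open 'rV[R]_n)).

Section lebesgue_tuple.
Context {R : realType}.
Local Notation RT := (measurableTypeR R).

Section step.
Variables (n : nat) (m : {sigma_finite_measure set (n.-tuple RT) -> \bar R}).

Let tcons (p : RT * n.-tuple RT) : n.+1.-tuple RT :=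
  [the n.+1.-tuple RT of p.1 :: p.2].

Let measurable_tcons : measurable_fun setT tcons.
Proof. exact: measurable_cons. Qed.

Definition lebesgue_cons : set (n.+1.-tuple RT) -> \bar R :=
  pushforward (@lebesgue_measure R \x m)%E tcons.

Let lebesgue_cons0 : lebesgue_cons set0 = 0%E.
Proof. by rewrite /lebesgue_cons /pushforward preimage_set0 measure0. Qed.

Let lebesgue_cons_ge0 A : (0 <= lebesgue_cons A)%E.
Proof. exact: measure_ge0. Qed.

Let lebesgue_cons_sigma_additive : semi_sigma_additive lebesgue_cons.
Proof.
pose f : {mfun _ >-> _} := HB.pack tcons (isMeasurableFun.Build _ _ _ _ tcons measurable_tcons).
exact: (@measure_semi_sigma_additive _ _ _ (pushforward (lebesgue_measure \x m)%E f)).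
Qed.

HB.instance Definition _ := isMeasure.Build _ _ _ lebesgue_cons
  lebesgue_cons0 lebesgue_cons_ge0 lebesgue_cons_sigma_additive.

Let lebesgue_cons_sigma_finite : sigma_finite setT lebesgue_cons.
Proof.
have /sigma_finiteP[F [TF ndF Foo]] := sigma_finiteT (@lebesgue_measure R).
have /sigma_finiteP[G [TG ndG Goo]] := sigma_finiteT m.
pose g (t : n.+1.-tuple RT) : RT * n.-tuple RT :=
  (tnth t ord0, [tuple of behead t]).
have mg : measurable_fun setT g.
  apply/measurable_fun_pair; first exact: measurable_tnth.
  exact: measurable_behead.
have gK p : g (tcons p) = p.
  by case: p => x t; rewrite /g /tcons/=; congr pair; exact/val_inj.
exists (fun k => g @^-1` (F k `*` G k)).
  rewrite -preimage_bigcup; apply/esym/seteqP; split => // t _ /=.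
  have [i _ Fi] : (\bigcup_i F i) (g t).1 by rewrite -TF.
  have [j _ Gj] : (\bigcup_i G i) (g t).2 by rewrite -TG.
  exists (maxn i j) => //; split.
    by move: Fi; exact/subsetPset/ndF/leq_maxl.
  by move: Gj; exact/subsetPset/ndG/leq_maxr.
move=> k; have [mF Fk] := Foo k; have [mG Gk] := Goo k; split.
  by rewrite -[X in measurable X]setTI; apply: mg => //; exact: measurableX.
rewrite /lebesgue_cons /pushforward -comp_preimage.
rewrite (_ : g \o tcons = id) ?preimage_id; last exact/funext.
by rewrite product_measure1E// lte_mul_pinfty// ge0_fin_numE.
Qed.

HB.instance Definition _ := Measure_isSigmaFinite.Build _ _ _ lebesgue_cons
  lebesgue_cons_sigma_finite.

End step.

(* Lebesgue measure of R^n, built on n-tuples by iterating the product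
   measure; [lebesgue_rV] below transports it to 'rV[R]_n. *)
Fixpoint lebesgue_tuple (n : nat) :
    {sigma_finite_measure set (n.-tuple RT) -> \bar R} :=
  match n with
  | 0%N => \d_([tuple] : 0.-tuple RT)
  | k.+1 => lebesgue_cons (lebesgue_tuple k)
  end.

End lebesgue_tuple.

Section lebesgue_rV.
Context {R : realType} {n : nat}.
Local Notation RT := (measurableTypeR R).

Let row_of (t : n.-tuple RT) : borel R n := \row_i tnth t i.

Let box (qk : {ffun 'I_n -> rat} * nat) : set 'rV[R]_n :=
  [set x | forall i, ball (ratr (qk.1 i) : R) (qk.2.+1%:R^-1) (x ord0 i)].

Let open_box (U : set 'rV[R]_n) : open U ->
  U = \bigcup_(p in [set p | box p `<=` U]) box p.
Proof.
move=> oU; apply/seteqP; split=> [x Ux|x [p pU px]]; last exact: pU.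
have : nbhs x U by exact: open_nbhs_nbhs.
rewrite -nbhs_ballE => -[e /= e0 xeU].
have [k ke] : exists k : nat, k.+1%:R^-1 < e / 2.
  have e20 : 0 < e / 2 by rewrite divr_gt0.
  have [k _ /(_ k (leqnn k))] := near_infty_natSinv_lt (PosNum e20).
  by exists k.
have k0 : 0 < k.+1%:R^-1 :> R by rewrite invr_gt0 ltr0n.
have /choice[q xq] : forall i, exists q : rat,
    ball (ratr q : R) (k.+1%:R^-1) (x ord0 i).
  move=> i.
  have [|q] := @rat_in_itvoo R (x ord0 i - k.+1%:R^-1) (x ord0 i + k.+1%:R^-1).
    by rewrite ltrBlDr -addrA ltrDl addr_gt0.
  rewrite in_itv/= => /andP[q1 q2]; exists q.
  by rewrite /ball/= ltr_norml ltrBrDl q1/= ltrBlDl q2.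
exists ([ffun i => q i], k) => /=; last by move=> i; rewrite ffunE.
move=> y /= yq; apply: xeU; split => // i j; rewrite ord1.
have := yq j; rewrite ffunE /= => yj.
rewrite (splitr e). apply: (@ball_triangle R R (ratr (q j) : R)).
- by apply/ball_sym; apply: le_ball (xq j); exact/ltW.
- by apply: le_ball yj; exact/ltW.
Qed.

Let measurable_row_of : measurable_fun setT row_of.
Proof.
apply: (@measurability _ _ _ (borel R n) _ row_of (@open 'rV[R]_n)) => // _ [U oU <-].
rewrite setTI.
rewrite (open_box oU) preimage_bigcup bigcup_mkcond.
apply: (@countable_bigcupT_measurable _ _ _); first exact: countableP.
move=> p; case: ifPn => // _.
rewrite (_ : _ @^-1` _ = \bigcap_(i in [set: 'I_n])
    ((fun t : n.-tuple RT => tnth t i) @^-1` ball (ratr (p.1 i) : R) (p.2.+1%:R^-1))).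
  apply: fin_bigcap_measurable => // i _.
  rewrite -[X in measurable X]setTI; apply: measurable_tnth => //.
  exact: measurable_realfun.measurable_ball.
by apply/seteqP; split => [t /= tp i _|t /= tp i]; have := tp i; rewrite /= mxE//; exact.
Qed.

Definition lebesgue_rV : set (borel R n) -> \bar R :=
  pushforward (@lebesgue_tuple R n) row_of.

Let lebesgue_rV0 : lebesgue_rV set0 = 0%E.
Proof. by rewrite /lebesgue_rV /pushforward preimage_set0 measure0. Qed.

Let lebesgue_rV_ge0 A : (0 <= lebesgue_rV A)%E.
Proof. exact: measure_ge0. Qed.

Let lebesgue_rV_sigma_additive : semi_sigma_additive lebesgue_rV.
Proof.
pose f : {mfun _ >-> _} :=
  HB.pack row_of (isMeasurableFun.Build _ _ _ _ row_of measurable_row_of).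
exact: (@measure_semi_sigma_additive _ _ _ (pushforward (lebesgue_tuple n) f)).
Qed.

HB.instance Definition _ := isMeasure.Build _ _ _ lebesgue_rV
  lebesgue_rV0 lebesgue_rV_ge0 lebesgue_rV_sigma_additive.

End lebesgue_rV.

Section sphere_measure.
Context {R : realType} {n : nat}.

Let enorm_continuous : continuous (@enorm R n).
Proof.
move=> x; apply: (@continuous_comp _ _ _ (fun y => dot y y) Num.sqrt);
  last exact: sqrt_continuous.
rewrite /dot; move: x; apply: continuous_big; first exact: add_continuous.
move=> i _ x; have xi := @coord_continuous R 1 n ord0 i x.
exact: (cvgM xi xi).
Qed.

Let open_measurable (U : set 'rV[R]_n) : open U -> measurable (U : set (borel R n)).
Proof. exact: sub_sigma_algebra. Qed.

Let sphere_proj_at (x : 'rV[R]_n) : enorm x != 0 -> {for x, continuous (@sphere_proj R n)}.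
Proof.
move=> x0 A [P Px PA].
have Q i : \forall y \near x, P ord0 i (sphere_proj y ord0 i).
  have : (fun y : 'rV[R]_n => (enorm y)^-1 * y ord0 i) @ x --> (enorm x)^-1 * x ord0 i.
    have xi := @coord_continuous R 1 n ord0 i x.
    exact: (cvgM (cvgV x0 (@enorm_continuous x)) xi).
  have Pi := Px ord0 i; rewrite mxE in Pi.
  move=> /(_ _ Pi); apply: (@filterS _ (nbhs x)) => y /=.
  by rewrite !mxE.
have QP := @filter_forall _ _ _ (nbhs x) (nbhs_filter x) Q.
suff : nbhs x (@sphere_proj R n @^-1` A) by [].
by apply: (@filterS _ _ (nbhs_filter x) _ _ _ QP) => y Py; apply: PA => i j; rewrite ord1; exact: Py.
Qed.

Let measurable_sphere_proj :
  measurable_fun [set: borel R n] (@sphere_proj R n : borel R n -> borel R n).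
Proof.
apply: (@measurability _ _ _ (borel R n) _ _ (@open 'rV[R]_n)) => // _ [U oU <-].
rewrite setTI.
pose V := [set x : 'rV[R]_n | enorm x != 0].
have oV : open V.
  rewrite (_ : V = @enorm R n @^-1` [set r | r != 0])//.
  by apply: open_comp => [? _|]; [exact: enorm_continuous|exact: open_neq].
rewrite -(setIT (_ @^-1` _)) -(setUv V) setIUr.
apply: measurableU.
  apply: open_measurable; rewrite openE => x [Ux Vx] /=.
  apply: filterI; last exact: open_nbhs_nbhs.
  by apply: sphere_proj_at => //; exact: open_nbhs_nbhs.
have proj0 (x : 'rV[R]_n) : (~` V) x -> sphere_proj x = 0.
  by move=> /negP; rewrite negbK => /eqP x0; rewrite /sphere_proj x0 invr0 scale0r.
have mV : measurable (~` V : set (borel R n)).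
  by apply: measurableC; exact: open_measurable.
have [U0|U0] := pselect (U 0).
  rewrite (_ : _ `&` _ = ~` V)//; apply/seteqP; split => [x []//|x Vx].
  by split => //=; rewrite proj0.
rewrite (_ : _ `&` _ = set0)//; apply/seteqP; split => // x [/= + Vx].
by rewrite proj0.
Qed.

Let ball0 : set (borel R n) := [set x : 'rV[R]_n | 0 < enorm x <= 1].

Let measurable_ball0 : measurable ball0.
Proof.
rewrite (_ : ball0 = (@enorm R n @^-1` [set r | 0 < r]) `&`
   ~` (@enorm R n @^-1` [set r | 1 < r])); last first.
  apply/seteqP; split=> x /=.
    by move=> /andP[x0 x1]; split => //; apply/negP; rewrite -leNgt.
  by move=> [x0 /negP]; rewrite -leNgt => x1; apply/andP.
apply: measurableI; last apply: measurableC.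
all: apply: open_measurable; apply: open_comp => [? _|]; last exact: open_gt.
all: exact: enorm_continuous.
Qed.

(* Spherical Lebesgue measure, as the Borel measure on R^n carried by the
   sphere whose value at A is n times the volume of the cone
   { r v | 0 < r <= 1, v in A, |v| = 1 }. *)
Definition sphere_measure (A : set (borel R n)) : \bar R :=
  (n%:R%:E * lebesgue_rV ([set x : 'rV[R]_n | 0 < enorm x <= 1]%R `&`
                          @sphere_proj R n @^-1` A))%E.

Let sphere_measure0 : sphere_measure set0 = 0%E.
Proof. by rewrite /sphere_measure preimage_set0 setI0 measure0 mule0. Qed.

Let sphere_measure_ge0 A : (0 <= sphere_measure A)%E.
Proof. by rewrite mule_ge0. Qed.

Let sphere_measure_sigma_additive : semi_sigma_additive sphere_measure.
Proof.
pose mu := measure_function_pushforward__canonical__measure_function_Measure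
  (mrestr (@lebesgue_rV R n) measurable_ball0) measurable_sphere_proj.
have -> : sphere_measure = mscale n%:R%:nng mu.
  by apply/funext => A; rewrite /mscale /= /pushforward /mrestr setIC.
exact: measure_semi_sigma_additive.
Qed.

HB.instance Definition _ := isMeasure.Build _ _ _ sphere_measure
  sphere_measure0 sphere_measure_ge0 sphere_measure_sigma_additive.

End sphere_measure.

Section pseudo_cones.
Context {R : realType} {n : nat}.
Implicit Types (C K A : set 'rV[R]_n) (x y z u v : 'rV[R]_n).

Definition convex A := convex_set (A : set (convex_lmodType 'rV[R]_n)).

Definition contains_line A :=
  exists x y, y != 0 /\ forall t : R, A (x + t *: y).

Definition pointed_cone C :=
  [/\ closed C, convex C, forall (r : R) x, 0 <= r -> C x -> C (r *: x),
      C° !=set0 & ~ contains_line C].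

Definition dual_cone C : set 'rV[R]_n :=
  [set x | forall y, C y -> dot x y <= 0].

Definition Omega C : set 'rV[R]_n := sphere `&` C°.

(* The sphere is closed, so the closure in R^n is the closure in the sphere. *)
Definition cl_Omega_dual C : set 'rV[R]_n := closure (Omega (dual_cone C)).

Definition recession_cone K : set 'rV[R]_n :=
  [set z | forall x, K x -> K (x + z)].

Definition ps C : set (set 'rV[R]_n) :=
  [set K | [/\ K !=set0, closed K & convex K] /\
           [/\ K `<=` C, ~ K 0 & recession_cone K = C]].

(* junk value 0 when S has no minimum *)
Definition set_min (S : set R) : R := xget 0 (S `&` lbound S).

Definition radial K v : R := set_min [set r | 0 < r /\ K (r *: v)].

Definition outer_unit_normals K x : set 'rV[R]_n :=
  [set u | sphere u /\ forall y, K y -> dot (y - x) u <= 0].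

Definition normals_at_direction K v : set 'rV[R]_n :=
  outer_unit_normals K (radial K v *: v).

Definition eta C K : set 'rV[R]_n :=
  [set v | Omega C v /\ ~ exists! u, normals_at_direction K v u].

(* only meaningful on Omega C `\` eta C K; xget picks the unique normal *)
Definition radial_gauss K v : 'rV[R]_n := xget 0 (normals_at_direction K v).

Definition radial_gauss_preimage C K (w : set 'rV[R]_n) : set 'rV[R]_n :=
  (Omega C `\` eta C K) `&` radial_gauss K @^-1` w.

Definition dual_curvature C (q : R) K (w : set 'rV[R]_n) : \bar R :=
  ((n%:R^-1)%:E * \int[@sphere_measure R n]_(v in radial_gauss_preimage C K w)
                    (radial K v `^ q)%:E)%E.

End pseudo_cones.

(* Main.v *)
From HB Require Import structures.
Require Import Defs.
From mathcomp Require Import all_boot all_order all_algebra.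
From mathcomp Require Import all_classical all_reals all_analysis.
From mathcomp Require Import measurable_realfun lra ring.

(** The measure [phi] is realized by a variational argument. Write [r] for the radial function of a
    pseudo-cone [K], [h u] for the infimum of [- dot u x] over [x] in [K], that is, minus the support
    function, [V K] for the integral of [r ^ q] over [Omega C], and [M] for the total mass of [phi].
    The functional

      J K = (integral of - ln h with respect to phi) + (M / q) ln (V K)

    is invariant under dilations. On the pseudo-cones normalized by prescribing [r] in one interior
    direction it is bounded below, and it attains its minimum: the normalized pseudo-cones are
    sequentially compact ([normalized_compact]), the first term is lower semicontinuous by Fatou's
    lemma and the second one is continuous by dominated convergence ([minimizer_exists]).

    Let [K] be a minimizer, [F] a closed subset of [cl_Omega_dual C] and [lam > 1]. Cutting [K] so
    that [h] is multiplied by at least [lam] on [F] gives a Wulff shape whose radial function lies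
    between [r] and [lam r], and minimality bounds its [V] by [V K * lam ^ (q * phi F / M)]
    ([minimizer_wulff]). The radial function only changes in the directions moved by the cut, and
    when [lam] decreases to 1 these shrink to directions having a normal vector in [F]. A convexity
    inequality turns the bound on [V] into

      (integral of r ^ q over the directions with a normal vector in F) >= V K * phi F / M

    for every such [F] ([nu_normals]). For [F = cl_Omega_dual C] this says that almost every
    direction has a normal vector there. Almost every direction has at most one: [1 / r] is the
    restriction of a concave function, which along each line parallel to a coordinate axis fails to
    be differentiable in at most countably many points, and Fubini's theorem applies
    ([kinks_null]).

    Hence the image under the radial Gauss map of the measure with density [r ^ q] dominates
    [(V K / M) phi] on closed sets. Both measures have total mass [V K], so they agree
    ([measure_eq_of_closed_le], [curvature_eq]), and a dilation of [K] adjusts the constant factor. *)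

Set Implicit Arguments.
Unset Strict Implicit.
Unset Printing Implicit Defensive.

Import Order.TTheory GRing.Theory Num.Theory.
Import numFieldNormedType.Exports.

Local Open Scope classical_set_scope.
Local Open Scope ring_scope.

(** * Scalar product and Euclidean norm *)

Section euclid.
Context {R : realType} {n : nat}.
Implicit Types (u x y z v : 'rV[R]_n) (K : set 'rV[R]_n).

Lemma dotC x y : dot x y = dot y x.
Proof. by rewrite /dot; apply: eq_bigr => i _; rewrite mulrC. Qed.

Lemma dotDr u x y : dot u (x + y) = dot u x + dot u y.
Proof. by rewrite /dot -big_split; apply: eq_bigr => i _; rewrite mxE mulrDr. Qed.

Lemma dotZr (r : R) u x : dot u (r *: x) = r * dot u x.
Proof. by rewrite /dot mulr_sumr; apply: eq_bigr => i _; rewrite mxE mulrCA. Qed.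

Lemma dotNr u x : dot u (- x) = - dot u x.
Proof. by rewrite -scaleN1r dotZr mulN1r. Qed.

Lemma dotBr u x y : dot u (x - y) = dot u x - dot u y.
Proof. by rewrite dotDr dotNr. Qed.

Lemma dotBl u x y : dot (x - y) u = dot x u - dot y u.
Proof. by rewrite !(dotC _ u) dotBr. Qed.

Lemma dotZl (r : R) u x : dot (r *: x) u = r * dot x u.
Proof. by rewrite !(dotC _ u) dotZr. Qed.

Lemma dot_delta u i : dot u (delta_mx ord0 i) = u ord0 i.
Proof.
rewrite /dot (bigD1 i)//= mxE !eqxx mulr1 big1 ?addr0// => j ji.
by rewrite mxE eqxx/= (negbTE ji) mulr0.
Qed.

Lemma cvg_dot (T : Type) (F : set_system T) {FF : Filter F} (f g : T -> 'rV[R]_n) u x :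
  f @ F --> u -> g @ F --> x -> (fun t => dot (f t) (g t)) @ F --> dot u x.
Proof.
move=> fu gx; rewrite /dot; apply: cvg_big => [|i _]; first exact: add_continuous.
apply: cvgM.
- exact: (cvg_comp _ _ fu (@coord_continuous R 1 n ord0 i u)).
- exact: (cvg_comp _ _ gx (@coord_continuous R 1 n ord0 i x)).
Qed.

Lemma dot_continuous u : continuous (dot u).
Proof. move=> x; have := @cvg_dot _ (nbhs x) _ (fun=> u) id u x (cvg_cst _) cvg_id; exact. Qed.

Lemma coord_norm_le x i : `|x ord0 i| <= `|x|.
Proof.
rewrite [leRHS]/Num.norm /= mx_normrE; apply/bigmax_geP; right => /=.
by exists (ord0, i).
Qed.

Lemma norm_dot_le u x : `|dot u x| <= n%:R * (`|u| * `|x|).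
Proof.
apply: le_trans (ler_norm_sum _ _ _) _.
rewrite -[X in X%:R * _]card_ord mulr_natl -sumr_const.
by apply: ler_sum => i _; rewrite normrM ler_pM// coord_norm_le.
Qed.

Lemma dotxx_ge0 x : 0 <= dot x x.
Proof. by apply: sumr_ge0 => i _; rewrite -expr2 sqr_ge0. Qed.

Lemma enorm_continuous : continuous (@enorm R n).
Proof.
move=> x; apply: (@continuous_comp _ _ _ (fun y => dot y y) Num.sqrt);
  last exact: sqrt_continuous.
exact: (@cvg_dot _ (nbhs x) _ id id x x cvg_id cvg_id).
Qed.

Lemma enormZ (r : R) x : 0 <= r -> enorm (r *: x) = r * enorm x.
Proof.
move=> r0; rewrite /enorm dotZl dotZr mulrA -expr2 sqrtrM ?sqr_ge0//.
by rewrite sqrtr_sqr ger0_norm.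
Qed.

Lemma coord_enorm_le x i : `|x ord0 i| <= enorm x.
Proof.
rewrite -sqrtr_sqr /enorm ler_wsqrtr// /dot (bigD1 i)//= expr2 lerDl.
by apply: sumr_ge0 => j _; rewrite -expr2 sqr_ge0.
Qed.

Lemma norm_le_enorm x : `|x| <= enorm x.
Proof.
rewrite [leLHS]/Num.norm /= mx_normrE; apply/bigmax_leP; split.
  exact: sqrtr_ge0.
by move=> [i j] _ /=; rewrite ord1 coord_enorm_le.
Qed.

Lemma enorm_gt0 x : x != 0 -> 0 < enorm x.
Proof.
by move=> x0; apply: lt_le_trans (norm_le_enorm x); rewrite normr_gt0.
Qed.

Lemma dot_sphere u : sphere u -> dot u u = 1.
Proof.
by move=> u1; rewrite -(sqr_sqrtr (dotxx_ge0 u)) -/(enorm u) u1 expr1n.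
Qed.

Lemma sphere_norm_le1 u : sphere u -> `|u| <= 1.
Proof. by move=> <-; exact: norm_le_enorm. Qed.

Lemma closed_sphere : closed (@sphere R n).
Proof.
rewrite (_ : sphere = @enorm R n @^-1` [set r | r = 1])//.
by apply: closed_comp => [? _|]; [exact: enorm_continuous|exact: closed_eq].
Qed.

Lemma compact_sphere : compact (@sphere R n).
Proof.
apply: bounded_closed_compact; last exact: closed_sphere.
exists 1; split => // M M1 u u1; apply: le_trans (ltW M1).
exact: sphere_norm_le1.
Qed.

Lemma cvg_scale1 (T : Type) (F : set_system T) {FF : Filter F} (f : T -> R) (r : R) x :
  f @ F --> r -> (fun t => f t *: x) @ F --> r *: x.
Proof. by move=> fr; apply: cvgZ => //; exact: cvg_cst. Qed.

Lemma convexP K : convex K <->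
  (forall x y (t : R), 0 < t < 1 -> K x -> K y -> K (t *: x + (1 - t) *: y)).
Proof.
split => [cK x y t /andP[t0 t1] Kx Ky|cK].
  have tt : 0 <= t <= 1 by rewrite !ltW.
  have := cK x y (Itv01 (ltW t0) (ltW t1)).
  by move=> /(_ (mem_set Kx) (mem_set Ky)) H; exact: (set_mem H).
apply/convex_setW => x y xK yK t t0 t1; have Kx := set_mem xK; have Ky := set_mem yK.
by apply/mem_set; apply: cK => //; rewrite t0 t1.
Qed.

End euclid.

(** * Pointed cones and their pseudo-cones *)

Section cone.
Context {R : realType} {n : nat}.
Implicit Types (u x y z v : 'rV[R]_n) (K : set 'rV[R]_n).
Variables (C : set 'rV[R]_n).
Hypothesis hC : pointed_cone C.

Lemma cone_closed : closed C. Proof. by case: hC. Qed.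

Lemma coneZ (r : R) x : 0 <= r -> C x -> C (r *: x).
Proof. by case: hC => _ _ h _ _; exact: h. Qed.

Lemma coneD x y : C x -> C y -> C (x + y).
Proof.
move=> Cx Cy; have [_ /convexP cC _ _ _] := hC.
have h : 0 < (2^-1 : R) < 1.
  by rewrite invr_gt0 ltr0n invf_lt1 ?ltr0n ?ltr1n.
have h2 : (2 : R) * 2^-1 = 1 by rewrite mulfV ?pnatr_eq0.
have := coneZ (ler0n R 2) (cC _ _ _ h Cx Cy); rewrite scalerDr !scalerA.
by rewrite mulrBr h2 mulr1 scale1r [X in X *: y](_ : _ = 1) ?scale1r// -[2]/(1 + 1) addrK.
Qed.

Lemma cone0 : C 0.
Proof.
have [_ _ _ [x Cx] _] := hC.
by rewrite -(scale0r x); apply: coneZ => //; exact: interior_subset Cx.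
Qed.

Lemma int_coneZ (r : R) x : 0 < r -> nbhs x C -> nbhs (r *: x) C.
Proof.
move=> r0 Cx.
have : (fun y => r^-1 *: y) @ (r *: x) --> r^-1 *: (r *: x).
  exact: scaler_continuous.
rewrite scalerA mulVf ?gt_eqF// scale1r => /(_ _ Cx) H.
move: H; apply: (@filterS _ (nbhs (r *: x))) => y /= /(coneZ (ltW r0)).
by rewrite scalerA mulfV ?gt_eqF// scale1r.
Qed.

Lemma int_coneDl x y : nbhs x C -> C y -> nbhs (x + y) C.
Proof.
move=> Cx Cy.
have : (fun z => z - y) @ (x + y) --> x + y - y.
  exact: (cvgB (@cvg_id _ (nbhs (x + y))) (cvg_cst y)).
rewrite addrK => /(_ _ Cx); apply: (@filterS _ (nbhs (x + y))) => z /= Czy.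
by rewrite -(subrK y z); exact: coneD.
Qed.


(** Otherwise the cone would be the whole space, which contains a line. *)
Lemma int_cone0F : (0 < n)%N -> ~ nbhs (0 : 'rV[R]_n) C.
Proof.
move=> n0 C0; have [_ _ _ _] := hC; apply.
pose d : 'rV[R]_n := delta_mx ord0 (Ordinal n0).
have d0 : d != 0.
  apply/eqP => /rowP /(_ (Ordinal n0)); rewrite !mxE !eqxx/= => /eqP.
  by rewrite oner_eq0.
have CC x : C x.
  have : (fun r : R => r *: x) @ (0 : R) --> (0 : R) *: x.
    by apply: cvg_scale1; exact: cvg_id.
  rewrite scale0r => /(_ _ C0) /nbhs_ballP[e /= e0] /(_ (e / 2)).
  have e20 : 0 < e / 2 by rewrite divr_gt0.
  have h : ball (0 : R) e (e / 2).
    by rewrite /ball/= sub0r normrN gtr0_norm// ltr_pdivrMr// ltr_pMr// ltr1n.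
  move=> /(_ h)/= /(coneZ (ltW (_ : 0 < (e / 2)^-1))).
  rewrite scalerA mulVf ?gt_eqF// scale1r; apply.
  by rewrite invr_gt0.
by exists 0, d; split => // t; exact: CC.
Qed.

Lemma int_coneN x : (0 < n)%N -> nbhs x C -> ~ C (- x).
Proof.
move=> n0 Cx /(int_coneDl Cx); rewrite subrr; exact: int_cone0F.
Qed.

(** The bound is uniform in [u] because one radius [d] keeps all the points [x + d u] in the cone. *)
Lemma int_cone_dot x : nbhs x C ->
  exists2 d : R, 0 < d & forall u, sphere u -> dual_cone C u -> d <= - dot u x.
Proof.
move=> /nbhs_ballP[e /= e0 xeC].
exists (e / 2); first by rewrite divr_gt0.
move=> u su du.
have h : ball x e (x + (e / 2) *: u).
  rewrite -ball_normE /ball_/= opprD addrA subrr sub0r normrN normrZ gtr0_norm ?divr_gt0//.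
  apply: (@le_lt_trans _ _ (e / 2)).
    by apply: ler_piMr; [rewrite divr_ge0 ?ltW|exact: sphere_norm_le1].
  by rewrite ltr_pdivrMr// ltr_pMr// ltr1n.
have := du _ (xeC _ h); rewrite dotDr dotZr dot_sphere// mulr1.
by move=> ?; rewrite lerNr; lra.
Qed.

Lemma int_cone_dot_gt0 x u : sphere u -> dual_cone C u -> nbhs x C -> 0 < - dot u x.
Proof.
by move=> su du /int_cone_dot[d d0 /(_ _ su du)]; exact: lt_le_trans.
Qed.

Lemma closed_dual_cone : closed (dual_cone C).
Proof.
rewrite (_ : dual_cone C = \bigcap_(y in C) [set u | dot y u <= 0]); last first.
  by apply/seteqP; split => [u du y Cy|u du y Cy]; [rewrite /= dotC; exact: du|
    rewrite dotC; exact: du].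
apply: closed_bigI => y _.
rewrite (_ : mkset _ = dot y @^-1` [set r | r <= 0])//.
by apply: closed_comp => [? _|]; [exact: dot_continuous|exact: closed_le].
Qed.

Lemma cl_Omega_dual_sub u : cl_Omega_dual C u -> sphere u /\ dual_cone C u.
Proof.
have cl : closed (@sphere R n `&` dual_cone C).
  by apply: closedI; [exact: closed_sphere|exact: closed_dual_cone].
rewrite /cl_Omega_dual => /(closureS _) h.
have : closure (@sphere R n `&` dual_cone C) u.
  by apply: h => w [sw iw]; split => //; exact: (interior_subset iw).
by rewrite -(closure_id _).1.
Qed.

Lemma closed_cl_Omega_dual : closed (cl_Omega_dual C).
Proof. exact: closed_closure. Qed.

Lemma ps_shift K x y : ps C K -> K x -> C y -> K (x + y).
Proof. by case=> _ [_ _ <-] Kx; exact. Qed.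

(** If [z] is a recession direction of [K] then [x + k z] stays in the closed cone [C] for every [k];
    dividing by [k] gives [z] in [C]. Hence stability of [K] under [C] is the only part of the
    recession condition that has to be verified. *)
Lemma ps_intro K : K !=set0 -> closed K -> convex K -> K `<=` C -> ~ K 0 ->
  (forall x y, K x -> C y -> K (x + y)) -> ps C K.
Proof.
move=> K0 Kcl Kco KC nK0 KD; split; split => //.
apply/seteqP; split => [z Kz|z Cz x Kx]; last exact: KD.
have [x Kx] := K0.
have Kxz k : K (x + k%:R *: z).
  elim: k => [|k /Kz]; first by rewrite scale0r addr0.
  by rewrite -addrA -[X in _ + X]/(_ *: z + z) -{2}(scale1r z) -scalerDl -natr1.
have h k : C (k.+1%:R^-1 *: x + z).
  have -> : k.+1%:R^-1 *: x + z = k.+1%:R^-1 *: (x + k.+1%:R *: z).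
    by rewrite scalerDr scalerA mulVf ?pnatr_eq0// scale1r.
  by apply: coneZ; [rewrite invr_ge0|exact: KC].
have : (fun k : nat => k.+1%:R^-1 *: x + z) @ \oo --> z.
  rewrite -[X in _ --> X]add0r; apply: cvgD; last exact: cvg_cst.
  by rewrite -(scale0r x); apply: cvg_scale1; exact: cvg_harmonic.
by apply: closed_cvg => //; [exact: cone_closed|exact: nearW].
Qed.

End cone.

(** * Radial functions *)

Section radial.
Context {R : realType} {n : nat}.
Implicit Types (u x y z v : 'rV[R]_n) (K : set 'rV[R]_n).
Variables (C : set 'rV[R]_n).
Hypothesis hC : pointed_cone C.

Lemma near_line (r : R) x (A : set 'rV[R]_n) :
  nbhs (r *: x) A -> \forall s \near r, A (s *: x).
Proof.
move=> rxA; have : (fun s : R => s *: x) @ r --> r *: x.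
  by apply: cvg_scale1; exact: cvg_id.
by move=> /(_ _ rxA).
Qed.

Lemma near_shift x y (A : set 'rV[R]_n) :
  nbhs (x - y) A -> \forall z \near x, A (z - y).
Proof.
move=> xyA; have : (fun z => z - y) @ x --> x - y.
  exact: (cvgB (@cvg_id _ (nbhs x)) (cvg_cst y)).
by move=> /(_ _ xyA).
Qed.

Lemma ps_up K x (r s : R) : ps C K -> C x -> r <= s -> K (r *: x) -> K (s *: x).
Proof.
move=> psK Cx rs Krx.
rewrite -(subrK r s) addrC scalerDl; apply: (ps_shift psK) => //.
by apply: coneZ => //; rewrite subr_ge0.
Qed.

Lemma ps_closed K : ps C K -> closed K. Proof. by case=> -[]. Qed.

Lemma ps_sub K : ps C K -> K `<=` C. Proof. by case=> _ []. Qed.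

Lemma radial_exists K v : ps C K -> nbhs v C ->
  exists r : R, [/\ 0 < r, K (r *: v) & forall s, 0 < s -> K (s *: v) -> r <= s].
Proof.
move=> psK Cv; pose S := [set r : R | 0 < r /\ K (r *: v)].
(* [K] is closed and misses the origin, so the admissible [r] stay away from 0 *)
have [d d0 Sd] : exists2 d : R, 0 < d & forall r, S r -> d <= r.
  have : nbhs ((0 : R) *: v) (~` K).
    rewrite scale0r; apply: open_nbhs_nbhs; split.
      by rewrite openC; exact: ps_closed.
    by case: psK => _ [].
  move=> /near_line/nbhs_ballP[d /= d0 dK]; exists d => // r [r0 Kr].
  rewrite leNgt; apply/negP => rd; apply: (dK r) => //.
  by rewrite /ball/= sub0r normrN gtr0_norm.
(* [v - s x] is in the cone for small [s > 0], hence [v / s] is in [x + C] *)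
have S0 : S !=set0.
  have [[[x Kx] _ _] _] := psK.
  have : nbhs (v - (0 : R) *: x) C by rewrite scale0r subr0.
  move=> h; have : (fun s : R => v - s *: x) @ (0 : R) --> v - (0 : R) *: x.
    by apply: cvgB; [exact: cvg_cst|apply: cvg_scale1; exact: cvg_id].
  move=> /(_ _ h) /nbhs_ballP[d' /= d'0] /(_ (d' / 2)).
  have h2 : 0 < d' / 2 by rewrite divr_gt0.
  have h' : ball (0 : R) d' (d' / 2).
    by rewrite /ball/= sub0r normrN gtr0_norm// ltr_pdivrMr// ltr_pMr// ltr1n.
  move=> /(_ h')/= Cvx; exists (d' / 2)^-1; split; first by rewrite invr_gt0.
  have -> : (d' / 2)^-1 *: v = x + (d' / 2)^-1 *: (v - (d' / 2) *: x).
    by rewrite scalerBr scalerA mulVf ?gt_eqF// scale1r addrC subrK.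
  by apply: (ps_shift psK) => //; apply: coneZ => //; rewrite invr_ge0 ltW.
have hi : has_inf S by split => //; exists d => r /Sd.
exists (inf S); split.
- by apply: lt_le_trans d0 _; apply: lb_le_inf => // r; exact: Sd.
- apply: contrapT => nK.
  have : nbhs (inf S *: v) (~` K).
    by apply: open_nbhs_nbhs; split => //; rewrite openC; exact: ps_closed.
  move=> /near_line/nbhs_ballP[e /= e0 eK].
  have [r [r0 Kr] rS] := inf_adherent e0 hi.
  apply: (eK r) => //; rewrite /ball/= distrC ger0_norm.
    by rewrite ltrBlDl.
  by rewrite subr_ge0; apply: ge_inf => //; exact: hi.2.
- by move=> s s0 Ks; apply: ge_inf; [exact: hi.2|split].
Qed.

Lemma radial_eq K v (r : R) : 0 < r -> K (r *: v) ->
  (forall s, 0 < s -> K (s *: v) -> r <= s) -> radial K v = r.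
Proof.
move=> r0 Kr rmin; rewrite /radial /set_min.
case: xgetP => [y _ [[y0 Ky] ylb]|/(_ r)[]].
  by apply/eqP; rewrite eq_le rmin// andbT; apply: ylb.
by split => // s [s0 Ks]; exact: rmin.
Qed.

Section pseudo_cone.
Variables (K : set 'rV[R]_n) (v : 'rV[R]_n).
Hypotheses (psK : ps C K) (Cv : nbhs v C).

Lemma radialP : [/\ 0 < radial K v, K (radial K v *: v) &
  forall s, 0 < s -> K (s *: v) -> radial K v <= s].
Proof.
have [r [r0 Kr rm]] := radial_exists psK Cv.
by rewrite (radial_eq r0 Kr rm); split.
Qed.

Lemma radial_gt0 : 0 < radial K v. Proof. by have [] := radialP. Qed.
Lemma radial_mem : K (radial K v *: v). Proof. by have [] := radialP. Qed.
Lemma radial_le s : 0 < s -> K (s *: v) -> radial K v <= s.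
Proof. by have [_ _] := radialP; exact. Qed.

Lemma radial_leE s : 0 < s -> (radial K v <= s) <-> K (s *: v).
Proof.
move=> s0; split => [rs|]; last exact: radial_le.
by apply: (ps_up psK _ rs radial_mem); exact: nbhs_singleton Cv.
Qed.

End pseudo_cone.

Lemma radial_subset K L v : ps C K -> ps C L -> L `<=` K -> nbhs v C ->
  radial K v <= radial L v.
Proof.
by move=> pK pL LK Cv; apply: (radial_le pK Cv); [exact: radial_gt0|apply/LK; exact: radial_mem].
Qed.

(** From above because [(r + e) v] lies in the interior of [r v + C], where [r] is the radial function
    at [v]; from below because the complement of [K] is open. *)
Lemma radial_continuous K v : ps C K -> nbhs v C -> {for v, continuous (radial K)}.
Proof.
move=> psK Cv; have rg := radial_gt0 psK Cv.
have CC : \forall w \near v, nbhs w C.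
  by move: Cv; rewrite nbhs_nearE => /near_join.
apply/(@cvgrPdist_le _ _ _ (nbhs v) (nbhs_filter v)) => e e0.
have up : \forall w \near v, radial K w <= radial K v + e.
  have h : nbhs ((radial K v + e) *: v - radial K v *: v) C.
    by rewrite -scalerBl addrC addKr; exact: int_coneZ.
  have : (fun w => (radial K v + e) *: w) @ v --> (radial K v + e) *: v.
    exact: scaler_continuous.
  move=> /(_ _ (near_shift h)).
  move=> h1; near=> w; apply: (radial_le psK); first by near: w.
    by rewrite addr_gt0.
  rewrite -(subrK (radial K v *: v) (_ *: w)) addrC.
  apply: (ps_shift psK); first exact: radial_mem.
  by near: w; exact: h1.
have lo : \forall w \near v, radial K v - e <= radial K w.
  have [re|re] := leP (radial K v - e) 0.
    near=> w; apply: le_trans re _; apply/ltW/(radial_gt0 psK).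
    by near: w.
  have h : nbhs ((radial K v - e) *: v) (~` K).
    apply: open_nbhs_nbhs; split; first by rewrite openC; exact: ps_closed.
    move=> /(radial_le psK Cv re); apply/negP; rewrite -ltNge.
    by rewrite ltrBlDr ltrDl.
  have : (fun w => (radial K v - e) *: w) @ v --> (radial K v - e) *: v.
    exact: scaler_continuous.
  move=> /(_ _ h) h1; near=> w.
  have Cw : nbhs w C by near: w; exact: CC.
  have nK : ~ K ((radial K v - e) *: w) by near: w; exact: h1.
  by rewrite leNgt; apply/negP => /ltW /(radial_leE psK Cw re).
near=> w; rewrite ler_norml; apply/andP; split.
  rewrite lerBrDl lerBlDr; near: w; exact: up.
by rewrite lerBlDr -lerBlDl; near: w; exact: lo.
Unshelve. all: by end_near. Qed.

Lemma radial_scale K v (s : R) : ps C K -> nbhs v C -> 0 < s ->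
  radial [set x | K (s^-1 *: x)] v = s * radial K v.
Proof.
move=> psK Cv s0; apply: radial_eq => /=.
- by rewrite mulr_gt0// radial_gt0.
- by rewrite scalerA mulKf ?gt_eqF//; exact: radial_mem.
- move=> r r0; rewrite scalerA => /(radial_le psK Cv).
  by rewrite mulr_gt0 ?invr_gt0// => /(_ isT); rewrite ler_pdivlMl.
Qed.

Lemma ps_scale K (s : R) : ps C K -> 0 < s -> ps C [set x | K (s^-1 *: x)].
Proof.
move=> psK s0; have [[[x0 Kx0] Kcl /convexP Kco] [KC K0 _]] := psK.
have si : 0 < s^-1 by rewrite invr_gt0.
apply: ps_intro => //=.
- by exists (s *: x0) => /=; rewrite scalerA mulVf ?gt_eqF// scale1r.
- rewrite (_ : mkset _ = (fun x => s^-1 *: x) @^-1` K)//.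
  by apply: closed_comp => // x _; exact: scaler_continuous.
- apply/convexP => x y t t01 /= Kx Ky.
  by rewrite scalerDr !scalerA ![s^-1 * _]mulrC -!scalerA; exact: Kco.
- move=> x /= /KC /(coneZ hC (ltW s0)).
  by rewrite scalerA mulfV ?gt_eqF// scale1r.
- by rewrite scaler0.
- move=> x y Kx Cy; rewrite scalerDr; apply: (ps_shift psK) => //.
  by apply: coneZ => //; exact: ltW.
Qed.

End radial.

(** * Sequential compactness of normalized pseudo-cones *)

Section diagonal.

Let infinitely_often (A : set nat) := forall N, exists2 i, (N <= i)%N & A i.

(** Cantor's diagonal argument, for countably many sequences of booleans. *)
Lemma diagonal_subsequence (b : nat -> nat -> bool) :
  exists2 s : nat -> nat, {homo s : i j / (i < j)%N} &
    forall k, exists c : bool, \forall i \near \oo, b k (s i) = c.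
Proof.
pose step k (A : set nat) c := A `&` [set i | b k i = c].
pose ch k A := `[< infinitely_often (step k A true) >].
pose A := fix A k := if k is k'.+1 then step k' (A k') (ch k' (A k')) else setT.
have Ainf k : infinitely_often (A k).
  elim: k => [N|k IH]; first by exists N.
  rewrite /= /ch; case: asboolP => // /existsNP[N hN] M.
  have [i Ni Ai] := IH (maxn N M); exists i.
    by apply: leq_trans Ni; exact: leq_maxr.
  split => //=; apply: contrapT => bki; apply: hN; exists i.
    by apply: leq_trans Ni; exact: leq_maxl.
  by split => //=; case: (b k i) bki.
have Adec k j : (k <= j)%N -> A j `<=` A k.
  elim: j => [|j IH]; first by rewrite leqn0 => /eqP ->.
  rewrite leq_eqVlt => /predU1P[->//|/IH h] i [+ _]; exact: h.
have /choice[f hf] : forall kN : nat * nat, exists i, (kN.2 <= i)%N /\ A kN.1 i.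
  by move=> [k N]; have [i] := Ainf k N; exists i.
pose s := fix s k := if k is k'.+1 then f (k, (s k').+1) else f (0%N, 0%N).
have As k : A k (s k).
  by case: k => [|k]; [exact: (hf (0, 0)%N).2|exact: (hf (k.+1, (s k).+1)).2].
exists s.
  apply: (homo_ltn ltn_trans) => k.
  by have [] := hf (k.+1, (s k).+1).
move=> k; exists (ch k (A k)); near=> i.
have : A k.+1 (s i) by apply: (Adec _ i) (As i); near: i; exact: nbhs_infty_ge.
by case.
Unshelve. all: by end_near. Qed.

End diagonal.

Section dense.
Context {R : realType} {n : nat}.

Definition ratv (z : 'rV[rat]_n) : 'rV[R]_n := map_mx ratr z.

Lemma rat_dense (A : set 'rV[R]_n) (x : 'rV[R]_n) : nbhs x A -> exists z, A (ratv z).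
Proof.
rewrite -nbhs_ballE => -[e /= e0 xeA].
have /choice[q xq] : forall i, exists q : rat, ball (x ord0 i) e (ratr q : R).
  move=> i.
  have [|q] := @rat_in_itvoo R (x ord0 i - e) (x ord0 i + e).
    by rewrite ltrBlDr -addrA ltrDl addr_gt0.
  rewrite in_itv/= => /andP[q1 q2]; exists q.
  by apply: ball_sym; rewrite /ball/= ltr_norml ltrBrDl q1/= ltrBlDl q2.
exists (\row_i q i); apply: xeA; split => // i j.
by rewrite ord1 !mxE; exact: xq.
Qed.

End dense.

Section compactness.
Context {R : realType} {n : nat}.
Implicit Types (u x y z v : 'rV[R]_n) (K : set 'rV[R]_n).
Variables (C : set 'rV[R]_n).
Hypothesis hC : pointed_cone C.
Variable e : 'rV[R]_n.
Hypothesis Ce : nbhs e C.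

(** Dilations are normalized away by prescribing the value of the radial function in one
    direction [e], which need not be a unit vector. *)
Definition normalized K := ps C K /\ radial K e = 1.

Lemma normalized_mem K : normalized K -> K e.
Proof. by move=> [psK re]; rewrite -(scale1r e) -re; exact: (radial_mem hC psK Ce). Qed.

(** Together, [x] in [K] and [e / 2 - x] in [C] would put [e / 2] into [K]. All normalized
    pseudo-cones therefore avoid one common neighbourhood of the origin. *)
Lemma normalized_half K x : normalized K -> C (2^-1 *: e - x) -> ~ K x.
Proof.
move=> [psK re] Cx Kx; have := ps_shift psK Kx Cx.
rewrite addrC subrK => /(radial_le hC psK Ce).
by rewrite re invr_gt0 ltr0n leNgt invf_lt1 ?ltr0n// ltr1n => /(_ isT).
Qed.

(** Every point is a limit of rational points that exceed it strictly in the order of the cone. *)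
Lemma near_above x (A : set 'rV[R]_n) : nbhs x A ->
  exists z : 'rV[rat]_n, A (ratv z) /\ nbhs (ratv z - x) C.
Proof.
move=> xA.
have : nbhs (x + (0 : R) *: e) (nbhs^~ A).
  by rewrite scale0r addr0; move: xA; rewrite nbhs_nearE => /near_join.
have : (fun r : R => x + r *: e) @ (0 : R) --> x + (0 : R) *: e.
  by apply: cvgD; [exact: cvg_cst|apply: cvg_scale1; exact: cvg_id].
move=> /[apply] /nbhs_ballP[d /= d0] /(_ (d / 2)).
have h2 : 0 < d / 2 by rewrite divr_gt0.
have h' : ball (0 : R) d (d / 2).
  by rewrite /ball/= sub0r normrN gtr0_norm// ltr_pdivrMr// ltr_pMr// ltr1n.
move=> /(_ h')/= xdA.
have xdC : nbhs (x + (d / 2) *: e - x) (nbhs^~ C).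
  rewrite addrC addKr.
  by have := int_coneZ hC h2 Ce; rewrite nbhs_nearE => /near_join.
have [z [z1 z2]] := rat_dense (filterI xdA (near_shift xdC)).
by exists z.
Qed.

Section limit.
Variable K_ : nat -> set 'rV[R]_n.
Hypothesis K_norm : forall i, normalized (K_ i).
Hypothesis K_dec : forall z : 'rV[rat]_n,
  (\forall i \near \oo, K_ i (ratv z)) \/ (\forall i \near \oo, ~ K_ i (ratv z)).

(** The limit is described by the rational points strictly above its elements: these
    eventually belong to the sets of the sequence. Rational points decide everything because the
    sets are stable under addition of elements of the cone. *)
Definition klim : set 'rV[R]_n :=
  [set x | forall z : 'rV[rat]_n, nbhs (ratv z - x) C ->
             \forall i \near \oo, K_ i (ratv z)].

Lemma klim_eventually x y : klim x -> nbhs (y - x) C ->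
  \forall i \near \oo, K_ i y.
Proof.
move=> Kx Cyx.
have h : nbhs (x - x) [set w | nbhs (y - x - w) C].
  rewrite subrr.
  have cv : (fun w => y - x - w) @ (0 : 'rV[R]_n) --> y - x - 0.
    exact: (cvgB (cvg_cst (y - x)) (@cvg_id _ (nbhs (0 : 'rV[R]_n)))).
  apply: (cv [set w | nbhs w C]); rewrite subr0.
  by move: Cyx; rewrite nbhs_nearE => /near_join.
have [z [/= yz zx]] := near_above (near_shift h).
have := Kx _ zx; apply: filterS => i Kiz.
rewrite -(subrK (ratv z) y) addrC; apply: (ps_shift (K_norm i).1 Kiz).
by move: (nbhs_singleton yz); rewrite opprB addrA subrK.
Qed.

Lemma klim_never x : ~ klim x -> \forall i \near \oo, ~ K_ i x.
Proof.
move=> /existsNP[z /not_implyP[zx nK]].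
have [//|] := K_dec z; apply: filterS => i nKz Kix; apply: nKz.
rewrite -(subrK x (ratv z)) addrC; apply: (ps_shift (K_norm i).1 Kix).
exact: nbhs_singleton zx.
Qed.

Lemma klim_e : klim e.
Proof.
move=> z ze; apply: nearW => i.
rewrite -(subrK e (ratv z)) addrC; apply: (ps_shift (K_norm i).1).
  exact: normalized_mem.
exact: nbhs_singleton ze.
Qed.

Lemma klim_shift x y : klim x -> C y -> klim (x + y).
Proof.
move=> Kx Cy z zxy; apply: Kx.
have -> : ratv z - x = ratv z - (x + y) + y by rewrite opprD addrA subrK.
exact: int_coneDl.
Qed.

Lemma klim_sub : klim `<=` C.
Proof.
move=> x Kx; have -> : x = x + (0 : R) *: e by rewrite scale0r addr0.
have h (k : nat) : C (x + k.+1%:R^-1 *: e).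
  have ke : nbhs (x + k.+1%:R^-1 *: e - x) C.
    by rewrite addrC addKr; apply: int_coneZ => //; rewrite invr_gt0.
  have [i] := filter_ex (klim_eventually Kx ke).
  exact: (ps_sub (K_norm i).1).
have : (fun k : nat => x + k.+1%:R^-1 *: e) @ \oo --> x + (0 : R) *: e.
  by apply: cvgD; [exact: cvg_cst|apply: cvg_scale1; exact: cvg_harmonic].
by apply: closed_cvg => //; [exact: cone_closed|exact: nearW].
Qed.

Lemma klim_closed : closed klim.
Proof.
rewrite (_ : klim = \bigcap_(z in [set z : 'rV[rat]_n |
    ~ \forall i \near \oo, K_ i (ratv z)]) [set x | ~ nbhs (ratv z - x) C]).
  apply: closed_bigI => z _; rewrite -openC openE => x /contrapT zx.
  have : (fun w => ratv z - w) @ x --> ratv z - x.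
    exact: (cvgB (cvg_cst (ratv z)) (@cvg_id _ (nbhs x))).
  move: zx; rewrite nbhs_nearE => /near_join h /(_ _ h).
  by apply: (@filterS _ (nbhs x)) => w /= hw; rewrite /setC/=; apply.
apply/seteqP; split => x /= Kx z.
  by move=> /= nK zx; apply: nK; exact: Kx.
by move=> zx; apply: contrapT => /(Kx z).
Qed.

Lemma klim_convex : convex klim.
Proof.
apply/convexP => x y t /andP[t0 t1] Kx Ky z zC.
have t1' : 0 < 1 - t by rewrite subr_gt0.
pose w := ratv z - (t *: x + (1 - t) *: y).
have h (a : 'rV[R]_n) : klim a -> \forall i \near \oo, K_ i (a + w).
  by move=> Ka; apply: klim_eventually Ka _; rewrite addrC addKr.
near=> i.
have h1 : K_ i (x + w) by near: i; exact: h.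
have h2 : K_ i (y + w) by near: i; exact: h.
have [[[_ _ /convexP cK] _] _] := K_norm i.
have := cK _ _ t _ h1 h2; rewrite t0 t1 => /(_ isT).
have -> : ratv z = t *: x + (1 - t) *: y + w by rewrite /w addrC subrK.
by rewrite (scalerDr t x w) (scalerDr (1 - t) y w) addrACA -scalerDl [t + _]addrC subrK scale1r.
Unshelve. all: by end_near. Qed.

Lemma klim0 : ~ klim 0.
Proof.
move=> K0.
have h : nbhs ((4^-1 : R) *: e - 0) C.
  by rewrite subr0; apply: int_coneZ => //; rewrite invr_gt0.
have [i] := filter_ex (klim_eventually K0 h); apply: normalized_half => //.
rewrite -scalerBl; apply: coneZ => //; last exact: nbhs_singleton Ce.
by rewrite subr_ge0 lef_pV2 ?posrE// ler_nat.
Qed.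

Lemma klim_ps : ps C klim.
Proof.
apply: (ps_intro hC); [by exists e; exact: klim_e|exact: klim_closed|
 exact: klim_convex|exact: klim_sub|exact: klim0|exact: klim_shift].
Qed.

(** Above the boundary point, points of the ray are eventually in the sets of the sequence; below
    it they are eventually outside. *)
Lemma klim_radial_cvg v : nbhs v C -> (fun i => radial (K_ i) v) @ \oo --> radial klim v.
Proof.
move=> Cv; have rg := radial_gt0 hC klim_ps Cv.
have up d : 0 < d -> \forall i \near \oo, radial (K_ i) v <= radial klim v + d.
  move=> d0.
  have h : nbhs ((radial klim v + d) *: v - radial klim v *: v) C.
    by rewrite -scalerBl addrC addKr; exact: int_coneZ.
  have := klim_eventually (radial_mem hC klim_ps Cv) h.
  apply: filterS => i Ki; apply: (radial_le hC (K_norm i).1) => //.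
  by rewrite addr_gt0.
have lo d : 0 < d -> \forall i \near \oo, radial klim v - d <= radial (K_ i) v.
  move=> d0; have [rd|rd] := leP (radial klim v - d) 0.
    apply: nearW => i; apply: le_trans rd _; apply/ltW.
    exact: (radial_gt0 hC (K_norm i).1).
  have : ~ klim ((radial klim v - d) *: v).
    move=> /(radial_le hC klim_ps Cv rd); apply/negP; rewrite -ltNge.
    by rewrite ltrBlDr ltrDl.
  move=> /klim_never; apply: filterS => i nKi; rewrite leNgt; apply/negP => /ltW.
  by move=> /(radial_leE hC (K_norm i).1 Cv rd).
apply/cvgrPdist_le => d d0; near=> i.
rewrite ler_norml; apply/andP; split.
  by rewrite lerBrDl lerBlDr; near: i; exact: up.
by rewrite lerBlDr -lerBlDl; near: i; exact: lo.
Unshelve. all: by end_near. Qed.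

Lemma klim_normalized : normalized klim.
Proof.
split; first exact: klim_ps.
have := klim_radial_cvg Ce; rewrite (_ : (fun _ => _) = cst 1).
  by move=> /(cvg_lim (@Rhausdorff R)) <-; exact: lim_cst.
by apply/funext => i; have [] := K_norm i.
Qed.

End limit.

(** Sequential compactness of the class of normalized pseudo-cones (a Blaschke selection theorem):
    a diagonal argument decides, for every rational point, whether it eventually belongs to the
    sets, and the recession cone turns this into convergence of radial functions. *)
Lemma normalized_compact (K_ : nat -> set 'rV[R]_n) :
  (forall i, normalized (K_ i)) ->
  exists s : nat -> nat, exists K, [/\ {homo s : i j / (i < j)%N}, normalized K,
    forall v, nbhs v C -> (fun i => radial (K_ (s i)) v) @ \oo --> radial K v &
    forall x y, K x -> nbhs (y - x) C -> \forall i \near \oo, K_ (s i) y].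
Proof.
move=> K_norm.
pose b k i := if unpickle k is Some z then `[< K_ i (ratv (z : 'rV[rat]_n)) >] else false.
have [s smono sb] := diagonal_subsequence b.
exists s, (klim (K_ \o s)).
have Kn i : normalized ((K_ \o s) i) by exact: K_norm.
have Kd (z : 'rV[rat]_n) : (\forall i \near \oo, (K_ \o s) i (ratv z)) \/
    (\forall i \near \oo, ~ (K_ \o s) i (ratv z)).
  have [[] ] := sb (pickle z); rewrite /b pickleK => h; [left|right];
    by move: h; apply: filterS => i /asboolP.
split => //; first exact: klim_normalized.
  by move=> v Cv; exact: klim_radial_cvg.
by move=> x y Kx; exact: (klim_eventually Kn Kx).
Qed.

End compactness.

(** * Borel sets, Lebesgue measure and spherical measure *)

Section borel.
Context {R : realType} {n : nat}.
Implicit Types (A U : set 'rV[R]_n).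

Lemma open_borel U : open U -> measurable (U : set (borel R n)).
Proof. exact: sub_sigma_algebra. Qed.

Lemma closed_borel U : closed U -> measurable (U : set (borel R n)).
Proof.
move=> cU; rewrite -(setCK U); apply: measurableC; apply: open_borel.
by rewrite openC.
Qed.

Lemma continuous_borel (f : 'rV[R]_n -> R) : continuous f ->
  measurable_fun setT (f : borel R n -> R).
Proof.
move=> cf; apply: (measurability _ (RGenOInfty.measurableE R)) => _ [_ [a ->] <-].
rewrite setTI; apply: open_borel; apply: open_comp => [? _|]; first exact: cf.
by rewrite set_itvE; exact: open_gt.
Qed.

Let box (qk : 'rV[rat]_n * nat) : set 'rV[R]_n :=
  [set x | forall i, ball (ratr (qk.1 ord0 i) : R) (qk.2.+1%:R^-1) (x ord0 i)].

Let open_box U : open U -> U = \bigcup_(p in [set p | box p `<=` U]) box p.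
Proof.
move=> oU; apply/seteqP; split=> [x Ux|x [p pU px]]; last exact: pU.
have : nbhs x U by exact: open_nbhs_nbhs.
rewrite -nbhs_ballE => -[e /= e0 xeU].
have [k ke] : exists k : nat, k.+1%:R^-1 < e / 2.
  have e20 : 0 < e / 2 by rewrite divr_gt0.
  have [k _ /(_ k (leqnn k))] := near_infty_natSinv_lt (PosNum e20).
  by exists k.
have k0 : 0 < k.+1%:R^-1 :> R by rewrite invr_gt0 ltr0n.
have [z xz] := rat_dense (nbhsx_ballx x _ k0).
have zx i : ball (ratr (z ord0 i) : R) k.+1%:R^-1 (x ord0 i).
  by case: xz => _ /(_ ord0 i); rewrite mxE => /ball_sym.
exists (z, k) => //= y /= yz; apply: xeU; split => // i j.
rewrite ord1 (splitr e); apply: (@ball_triangle R R (ratr (z ord0 j) : R)).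
- by apply/ball_sym; apply: le_ball (zx j); exact/ltW.
- by apply: le_ball (yz j); exact/ltW.
Qed.

(** Open sets are countable unions of boxes with rational centres and radii of the form [1 / k], and
    the preimage of a box is a finite intersection of preimages of intervals. *)
Lemma measurable_row d (T : measurableType d) (f : T -> 'rV[R]_n) :
  (forall i, measurable_fun setT (fun t => f t ord0 i)) ->
  measurable_fun setT (f : T -> borel R n).
Proof.
move=> mf.
apply: (@measurability _ _ _ (borel R n) _ f (@open 'rV[R]_n)) => // _ [U oU <-].
rewrite setTI (open_box oU) preimage_bigcup bigcup_mkcond.
apply: (@countable_bigcupT_measurable _ _ _); first exact: countableP.
move=> p; case: ifPn => // _.
rewrite (_ : _ @^-1` _ = \bigcap_(i in [set: 'I_n])
    ((fun t => f t ord0 i) @^-1` ball (ratr (p.1 ord0 i) : R) (p.2.+1%:R^-1))).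
  apply: fin_bigcap_measurable => // i _.
  rewrite -[X in measurable X]setTI; apply: mf => //.
  exact: measurable_ball.
by apply/seteqP; split => [t /= tp i _|t /= tp i]; exact: tp.
Qed.

Lemma measurable_coord (i : 'I_n) :
  measurable_fun setT (fun x : borel R n => (x : 'rV[R]_n) ord0 i).
Proof. by apply: continuous_borel; exact: coord_continuous. Qed.

Lemma measurable_sphere_proj :
  measurable_fun [set: borel R n] (@sphere_proj R n : borel R n -> borel R n).
Proof.
apply: measurable_row => i.
rewrite (_ : (fun _ => _) = (fun x : borel R n => enorm x `^ (-1) * (x : 'rV[R]_n) ord0 i)).
  apply: measurable_funM; last exact: measurable_coord.
  exact: (measurableT_comp (measurable_powR (R := R) (-1)) (continuous_borel enorm_continuous)).
by apply/funext => x; rewrite mxE powR_inv1// sqrtr_ge0.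
Qed.

Definition unit_ball0 : set 'rV[R]_n := [set x | 0 < enorm x <= 1].

Lemma measurable_unit_ball0 : measurable (unit_ball0 : set (borel R n)).
Proof.
rewrite (_ : unit_ball0 = (@enorm R n @^-1` [set r | 0 < r]) `&`
   (@enorm R n @^-1` [set r | r <= 1])); last first.
  by apply/seteqP; split=> x /= => [/andP[]|[? ?]]; last exact/andP.
apply: measurableI.
  apply: open_borel; apply: open_comp => [? _|]; last exact: open_gt.
  exact: enorm_continuous.
apply: closed_borel; apply: closed_comp => [? _|]; last exact: closed_le.
exact: enorm_continuous.
Qed.

End borel.

Section lebesgue.
Context {R : realType}.
Local Notation RT := (measurableTypeR R).

(** Tonelli in both orders, for the product with one more copy of the real line. *)
Lemma lebesgue_consE n (m : {sigma_finite_measure set (n.-tuple RT) -> \bar R})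
    (A : set (n.+1.-tuple RT)) : measurable A ->
  [/\ lebesgue_cons m A = (\int[lebesgue_measure]_x m [set t : n.-tuple RT | A [tuple of x :: t]])%E &
      lebesgue_cons m A = (\int[m]_t lebesgue_measure [set x : RT | A [tuple of x :: t]])%E].
Proof.
move=> mA.
pose tc (p : RT * n.-tuple RT) : n.+1.-tuple RT := [tuple of p.1 :: p.2].
have mtc : measurable_fun setT tc by exact: measurable_cons.
have mB : measurable (tc @^-1` A) by rewrite -[X in measurable X]setTI; exact: mtc.
have E : lebesgue_cons m A = ((@lebesgue_measure R) \x m)%E (tc @^-1` A) by [].
rewrite E; split.
  rewrite /= /product_measure1; apply: eq_integral => x _ /=; congr (m _).
  by apply/seteqP; split => t; rewrite /xsection/= in_setE.
transitivity (((@lebesgue_measure R) \x^ m)%E (tc @^-1` A)).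
  by apply: product_measure_unique => // B D mBB mD; exact: product_measure2E.
rewrite /= /product_measure2; apply: eq_integral => t _ /=; congr (lebesgue_measure _).
by apply/seteqP; split => x; rewrite /ysection/= in_setE.
Qed.

Definition set_coord n (i : 'I_n) (s : R) (t : n.-tuple RT) : n.-tuple RT :=
  [tuple if j == i then s else tnth t j | j < n].

(** By Fubini, the [i]-th coordinate may be integrated first, and countable sets of reals are null. *)
Lemma lebesgue_tuple_line n (i : 'I_n) (A : set (n.-tuple RT)) : measurable A ->
  (forall t, countable [set s | A (set_coord i s t)]) ->
  lebesgue_tuple n A = 0%E.
Proof.
elim: n i A => [[]//|n IH] i A mA Ai.
have [E0 ES] := lebesgue_consE (lebesgue_tuple n) mA.
case: (unliftP ord0 i) => [j ij|i0].
  etransitivity; first exact: E0.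
  apply: integral0_eq => x _; apply: (IH j).
    rewrite -[X in measurable X]setTI.
    have : measurable_fun setT (fun t : n.-tuple RT => [tuple of x :: t]).
      by apply: measurable_cons => //; exact: measurable_cst.
    by apply.
  move=> t; have := Ai [tuple of x :: t]; congr (countable _).
  apply/seteqP; split => s /=; congr (A _); apply: eq_from_tnth => k;
    rewrite tnth_mktuple; (case: (unliftP ord0 k) => [l ->|->];
    rewrite ?tnth0 ?tnthS ?tnth_mktuple ?ij ?(inj_eq lift_inj)//).
etransitivity; first exact: ES.
apply: integral0_eq => t _; apply: countable_lebesgue_measure0.
have := Ai [tuple of 0 :: t]; congr (countable _).
apply/seteqP; split => s /=; congr (A _); apply: eq_from_tnth => k;
  rewrite tnth_mktuple i0; (case: (unliftP ord0 k) => [l ->|->];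
  rewrite ?tnth0 ?tnthS//).
Qed.

Lemma measurable_tuple_box n (c : nat -> R) (r : R) :
  measurable [set t : n.-tuple RT | forall i : 'I_n, ball (c i) r (tnth t i)].
Proof.
rewrite (_ : mkset _ = \bigcap_(i in [set: 'I_n])
    ((fun t : n.-tuple RT => tnth t i) @^-1` ball (c i) r)).
  apply: fin_bigcap_measurable => // i _.
  rewrite -[X in measurable X]setTI; apply: measurable_tnth => //.
  exact: measurable_ball.
by apply/seteqP; split => [t /= tp i _|t /= tp i]; exact: tp.
Qed.

(** The centre is a function on all natural numbers so that the induction on [n] can shift it. *)
Lemma lebesgue_tuple_box n (c : nat -> R) (r : R) : 0 <= r ->
  lebesgue_tuple n [set t : n.-tuple RT | forall i : 'I_n, ball (c i) r (tnth t i)]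
  = ((r *+ 2) ^+ n)%:E.
Proof.
move=> r0; elim: n c => [|n IH] c.
  by rewrite /= expr0 diracE mem_set//= => -[].
have [E0 _] := lebesgue_consE (lebesgue_tuple n) (measurable_tuple_box (n := n.+1) c r).
etransitivity; first exact: E0.
pose B := [set t : n.-tuple RT | forall i : 'I_n, ball (c i.+1) r (tnth t i)].
have mB : measurable B by exact: measurable_tuple_box (c \o S) r.
pose B0 : set RT := ball (c 0%N : R) r.
have mB0 : measurable B0 by exact: measurable_ball.
transitivity (\int[lebesgue_measure]_(x in [set: RT]) ((\1_B0 x)%:E * ((r *+ 2) ^+ n)%:E))%E.
  apply: eq_integral => x _; rewrite indicE.
  have [xc|xc] := pselect (B0 x).
    rewrite mem_set// mul1e -(IH (c \o S)); congr (lebesgue_tuple n _).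
    apply/seteqP; split => t /= h i.
      by have := h (lift ord0 i); rewrite tnthS.
    have [j ->|->] := unliftP ord0 i; first by rewrite tnthS; exact: h.
    by rewrite tnth0.
  rewrite memNset// mul0e (_ : mkset _ = set0) ?measure0//.
  by apply/seteqP; split => // t /= /(_ ord0); rewrite tnth0.
etransitivity; first apply: ge0_integralZr => //.
- by apply: measurableT_comp => //; exact: measurable_indic.
- by rewrite lee_fin exprn_ge0// mulrn_wge0.
rewrite integral_indic// setIT [X in (X * _)%E](lebesgue_measure_ball _ r0).
by rewrite -EFinM -exprS.
Qed.

Lemma lebesgue_rVE n (A : set (borel R n)) :
  lebesgue_rV A = lebesgue_tuple n [set t : n.-tuple RT | A (\row_i tnth t i)].
Proof. by []. Qed.

Lemma measurable_row_of n (A : set (borel R n)) : measurable A ->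
  measurable [set t : n.-tuple RT | A (\row_i tnth t i)].
Proof.
have : measurable_fun setT ((fun t : n.-tuple RT => \row_i tnth t i) : _ -> borel R n).
  apply: measurable_row => i.
  rewrite (_ : (fun _ => _) = fun t : n.-tuple RT => tnth t i); first exact: measurable_tnth.
  by apply/funext => t; rewrite mxE.
by move=> mf mA; rewrite -[X in measurable X]setTI; exact: mf.
Qed.

End lebesgue.

Section sphere_measure.
Context {R : realType} {n : nat}.
Local Notation RT := (measurableTypeR R).
Local Notation sigma := (@sphere_measure R n).

Let cone_over (A : set 'rV[R]_n) : set (borel R n) := unit_ball0 `&` sphere_proj @^-1` A.

Let measurable_cone_over (A : set 'rV[R]_n) : measurable (A : set (borel R n)) ->
  measurable (cone_over A).
Proof.
move=> mA; apply: measurableI; first exact: measurable_unit_ball0.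
by rewrite -[X in measurable X]setTI; exact: measurable_sphere_proj.
Qed.

Lemma sphere_measure_fin : (sigma setT < +oo)%E.
Proof.
rewrite /sphere_measure preimage_setT setIT lte_mul_pinfty//.
rewrite lebesgue_rVE; apply: (@le_lt_trans _ _ (((2 : R) *+ 2) ^+ n)%:E); last exact: ltry.
rewrite -(@lebesgue_tuple_box R n (fun=> 0))//; apply: le_measure; rewrite ?inE.
- exact: (measurable_row_of measurable_unit_ball0).
- exact: (measurable_tuple_box (fun=> 0) 2).
- move=> t /= /andP[_ t1] i; rewrite /ball/= sub0r normrN.
  have := le_trans (coord_enorm_le _ i) t1; rewrite mxE => /le_lt_trans; apply.
  by rewrite ltr1n.
Qed.

(** The cone over [Omega C] contains a small box around an interior point of [C] of norm 1/2. *)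
Lemma sphere_measure_gt0 (C : set 'rV[R]_n) : (0 < n)%N -> pointed_cone C ->
  measurable (Omega C : set (borel R n)) -> (0 < sigma (Omega C))%E.
Proof.
move=> n0 hC mO; have [_ _ _ [x Cx] _] := hC.
have x0 : x != 0.
  by apply/eqP => x0; apply: (int_cone0F hC n0); rewrite -x0; exact: Cx.
have xe : 0 < enorm x by exact: enorm_gt0.
pose x' : 'rV[R]_n := (2 * enorm x)^-1 *: x.
have Cx' : nbhs x' (nbhs^~ C).
  have : nbhs x' C by apply: int_coneZ => //; rewrite invr_gt0 mulr_gt0.
  by rewrite nbhs_nearE => /near_join.
have ex' : enorm x' = 2^-1.
  by rewrite enormZ ?invr_ge0 ?mulr_ge0 ?ltW// invfM mulfVK ?gt_eqF.
have bx' : nbhs x' unit_ball0.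
  apply: (@filterS _ (nbhs x') _ (@enorm R n @^-1` `]0, 1[%classic)).
    by move=> y /=; rewrite in_itv/= => /andP[y0 y1]; rewrite /unit_ball0/= y0 ltW.
  apply: enorm_continuous; apply: open_nbhs_nbhs; split; first exact: interval_open.
  by rewrite /= in_itv/= ex' invr_gt0 ltr0n invf_lt1 ?ltr0n ?ltr1n.
have [d /= d0 dx'] := (@nbhs_ballP _ _ _ _).1 (filterI Cx' bx').
(* outside the index range the value of [c] is immaterial; 0 is a default *)
pose c (k : nat) := if insub k is Some i then x' ord0 i else 0.
have cE (i : 'I_n) : c i = x' ord0 i by rewrite /c valK.
rewrite /sphere_measure mule_gt0 ?lte_fin ?ltr0n// lebesgue_rVE.
have dn : (0 < ((d *+ 2) ^+ n)%:E)%E by rewrite lte_fin exprn_gt0// pmulrn_lgt0.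
apply: lt_le_trans dn _.
rewrite -(lebesgue_tuple_box n c (ltW d0)); apply: le_measure; rewrite ?inE.
- exact: (measurable_tuple_box c d).
- exact: (measurable_row_of (measurable_cone_over mO)).
- move=> t /= ht; have : ball x' d (\row_i tnth t i).
    by split => // i j; rewrite ord1 -cE mxE; exact: ht.
  move=> /dx'[/= Ct bt]; split => //.
  have [bt0 bt1] := andP bt.
  split; rewrite /sphere_proj.
    by rewrite /sphere/= enormZ ?invr_ge0 ?ltW// mulVf// gt_eqF.
  by apply: (int_coneZ hC) => //; rewrite invr_gt0.
Qed.

Lemma sphere_measure_line (i : 'I_n) (A : set 'rV[R]_n) :
  measurable (A : set (borel R n)) ->
  (forall x : 'rV[R]_n, countable [set s | (cone_over A) (\row_j if j == i then s else x ord0 j)]) ->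
  sigma A = 0%E.
Proof.
move=> mA h; rewrite /sphere_measure -/unit_ball0 -/(cone_over A) lebesgue_rVE.
rewrite (lebesgue_tuple_line (i := i)) ?mule0//.
  exact: (measurable_row_of (measurable_cone_over mA)).
move=> t; have := h (\row_j tnth t j); congr (countable _).
apply/seteqP; split => s /=; congr (cone_over _ _); apply/rowP => j;
  by rewrite !mxE tnth_mktuple.
Qed.

End sphere_measure.

(** * Normal vectors and the directions with several of them *)

Section normals.
Context {R : realType} {n : nat}.
Implicit Types (u x y z v : 'rV[R]_n).
Variables (C : set 'rV[R]_n).
Hypothesis hC : pointed_cone C.

Lemma measurable_Omega : measurable (Omega C : set (borel R n)).
Proof.
apply: measurableI; first by apply: closed_borel; exact: closed_sphere.
by apply: open_borel; exact: open_interior.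
Qed.

Variable K : set 'rV[R]_n.
Hypothesis psK : ps C K.
Local Notation normals := (normals_at_direction K).

Lemma normals_sphere v u : normals v u -> sphere u.
Proof. by case. Qed.

Lemma normals_dual v u : nbhs v C -> normals v u -> dual_cone C u.
Proof.
move=> Cv [su hu] y Cy.
have := hu _ (ps_shift psK (radial_mem hC psK Cv) Cy).
by rewrite [_ + y]addrC addrK dotC.
Qed.

Lemma normals_dot v u : nbhs v C -> normals v u -> dot u v < 0.
Proof.
move=> Cv uv; rewrite -oppr_gt0; apply: (int_cone_dot_gt0 _ _ Cv).
- exact: normals_sphere uv.
- exact: normals_dual uv.
Qed.

Lemma radial_homog v (r : R) : nbhs v C -> 0 < r ->
  radial K (r *: v) *: (r *: v) = radial K v *: v.
Proof.
move=> Cv r0; rewrite (@radial_eq _ _ K (r *: v) (r^-1 * radial K v)).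
- by rewrite scalerA mulrAC mulVf ?gt_eqF// mul1r.
- by rewrite mulr_gt0 ?invr_gt0//; exact: (radial_gt0 hC psK Cv).
- rewrite scalerA mulrAC mulVf ?gt_eqF// mul1r; exact: (radial_mem hC psK Cv).
- move=> s s0; rewrite scalerA => /(radial_le hC psK Cv).
  by rewrite mulr_gt0// => /(_ isT); rewrite ler_pdivrMl// mulrC.
Qed.

(** The graph of the normal map is closed and the sphere is compact, so the directions satisfying
    the condition form a relatively closed subset of [Omega C]. *)
Lemma measurable_normals (T : set ('rV[R]_n * 'rV[R]_n)) : closed T ->
  measurable ([set v | Omega C v /\ exists2 u, normals v u & T (u, v)] : set (borel R n)).
Proof.
move=> cT.
pose W := [set v : 'rV[R]_n | nbhs v C /\ forall u, sphere u -> ~ (normals v u /\ T (u, v))].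
rewrite (_ : mkset _ = Omega C `&` ~` W); last first.
  apply/seteqP; split => v /= [Ov].
    by move=> [u uv Tuv]; split => // -[_ /(_ u (normals_sphere uv))]; exact.
  move=> nW; split => //; apply: contrapT => nE; apply: nW; split; first exact: Ov.2.
  by move=> u su [uv Tuv]; apply: nE; exists u.
apply: measurableI; first exact: measurable_Omega.
apply: measurableC; apply: open_borel; rewrite openE => v [Cv hv].
rewrite /interior; apply: filterI.
  by move: Cv; rewrite nbhs_nearE => /near_join.
apply: ((compact_near_coveringP _).1 compact_sphere _ (nbhs v)) => u su.
(* near [(u, v)] the failing condition keeps failing *)
have [Tuv|nTuv] := pselect (T (u, v)); last first.
  have : nbhs (u, v) (~` T) by apply: open_nbhs_nbhs; split => //; rewrite openC.
  by apply: filterS => -[u' v'] /= h [].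
have : ~ normals v u by move=> uv; exact: (hv u su).
move=> /not_andP[//|/existsNP[y /not_implyP[Ky /negP]]]; rewrite -ltNge => h.
have cv : (fun p : 'rV[R]_n * 'rV[R]_n => dot (y - radial K p.2 *: p.2) p.1) @ (u, v) -->
    dot (y - radial K v *: v) u.
  apply: cvg_dot; last exact: cvg_fst.
  apply: cvgB; first exact: cvg_cst.
  apply: cvgZ; last exact: cvg_snd.
  by apply: (cvg_comp _ _ (@cvg_snd _ _ _ _ _)); exact: (radial_continuous hC psK Cv).
have := cv [set r | 0 < r] (open_nbhs_nbhs (conj (@open_gt R 0) h)).
apply: (@filterS _ (nbhs (u, v))) => -[u' v'] /= h' [[_ /(_ y Ky) le0] _].
by move: h'; rewrite ltNge le0.
Qed.

Lemma measurable_normals_in (F : set 'rV[R]_n) : closed F ->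
  measurable ([set v | Omega C v /\ exists2 u, normals v u & F u] : set (borel R n)).
Proof.
move=> cF; apply: (@measurable_normals [set p | F p.1]).
by apply: (closed_comp (f := fst)) => // -[p1 p2] _; exact: cvg_fst.
Qed.

(** With [r] the radial function, [1 / r] extends to a concave function on the interior of the cone,
    homogeneous of degree 1, whose supergradients at [v] are the vectors [u / (r v * dot u v)], with [u]
    a normal vector. Up to the positive factor [1 / r v], [slope i v u] is the [i]-th coordinate. *)
Definition slope i v u : R := u ord0 i / dot u v.

(** Directions at which [1 / radial K] has no partial derivative along the [i]-th axis. *)
Definition kinks i := [set v | Omega C v /\
  exists u, exists u', [/\ normals v u, normals v u' & slope i v u < slope i v u']].

Lemma closed_slope_le i (a : R) :
  closed [set p : 'rV[R]_n * 'rV[R]_n | a * dot p.1 p.2 <= p.1 ord0 i].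
Proof.
pose f (p : 'rV[R]_n * 'rV[R]_n) := p.1 ord0 i - a * dot p.1 p.2.
rewrite (_ : mkset _ = f @^-1` [set r | 0 <= r]); last first.
  by apply/seteqP; split => p; rewrite /f/= subr_ge0.
apply: closed_comp => [[p1 p2] _|]; last exact: closed_ge.
apply: (@cvgB _ _ _ (nbhs (p1, p2))).
  exact: (cvg_comp _ _ (@cvg_fst _ _ (nbhs p1) (nbhs p2) _) (@coord_continuous R 1 n ord0 i p1)).
by apply: cvgM; [exact: cvg_cst|apply: cvg_dot; [exact: cvg_fst|exact: cvg_snd]].
Qed.

Lemma closed_slope_ge i (a : R) :
  closed [set p : 'rV[R]_n * 'rV[R]_n | p.1 ord0 i <= a * dot p.1 p.2].
Proof.
pose f (p : 'rV[R]_n * 'rV[R]_n) := a * dot p.1 p.2 - p.1 ord0 i.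
rewrite (_ : mkset _ = f @^-1` [set r | 0 <= r]); last first.
  by apply/seteqP; split => p; rewrite /f/= subr_ge0.
apply: closed_comp => [[p1 p2] _|]; last exact: closed_ge.
apply: (@cvgB _ _ _ (nbhs (p1, p2))).
  by apply: cvgM; [exact: cvg_cst|apply: cvg_dot; [exact: cvg_fst|exact: cvg_snd]].
exact: (cvg_comp _ _ (@cvg_fst _ _ (nbhs p1) (nbhs p2) _) (@coord_continuous R 1 n ord0 i p1)).
Qed.

(** Two distinct slopes are separated by a pair of rational numbers, and the conditions that some
    slope lies on a given side of a rational number are relatively closed. *)
Lemma measurable_kinks i : measurable (kinks i : set (borel R n)).
Proof.
pose lo (a : rat) := [set v | Omega C v /\
   exists2 u, normals v u & (ratr a : R) * dot u v <= u ord0 i].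
pose hi (a : rat) := [set v | Omega C v /\
   exists2 u, normals v u & u ord0 i <= (ratr a : R) * dot u v].
rewrite (_ : kinks i = \bigcup_(ab in [set ab : rat * rat | ab.1 < ab.2]) (lo ab.1 `&` hi ab.2)).
  rewrite bigcup_mkcond.
  apply: (@countable_bigcupT_measurable _ _ _); first exact: countableP.
  move=> ab; case: ifPn => // _; apply: measurableI.
  - exact: (measurable_normals (@closed_slope_le i (ratr ab.1))).
  - exact: (measurable_normals (@closed_slope_ge i (ratr ab.2))).
apply/seteqP; split => [v [Ov [u [u' [uv u'v uu']]]]|v [[a b] /= ab [[Ov [u uv au]] [_ [u' u'v bu]]]]].
  have [b + ] := rat_in_itvoo uu'; rewrite in_itv/= => /andP[ub bu'].
  have [a + ] := rat_in_itvoo ub; rewrite in_itv/= => /andP[ua ab].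
  exists (a, b) => /=; first by move: ab; rewrite ltr_rat.
  split; split => //; [exists u|exists u'] => //.
    by rewrite -ler_ndivrMr ?ltW//; exact: normals_dot Ov.2 uv.
  by rewrite -ler_ndivlMr ?ltW//; exact: normals_dot Ov.2 u'v.
split => //; exists u, u'; split => //.
apply: (@le_lt_trans _ _ (ratr a)).
  by rewrite /slope ler_ndivrMr//; exact: normals_dot Ov.2 uv.
apply: (@lt_le_trans _ _ (ratr b)); first by rewrite ltr_rat.
by rewrite /slope ler_ndivlMr//; exact: normals_dot Ov.2 u'v.
Qed.

End normals.

Section kinks.
Context {R : realType}.

(** The intervals between two values at distinct points of [S] are disjoint and each of them contains
    a rational number. *)
Lemma nonincreasing_multimap_countable (S : set R) (P : R -> R -> Prop) :
  (forall s, S s -> exists a, exists b, [/\ a < b, P s a & P s b]) ->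
  (forall s s' a a', s < s' -> P s a -> P s' a' -> a' <= a) ->
  countable S.
Proof.
move=> SP Pmono.
have /choice[f hf] : forall s, exists q : rat, S s ->
    exists a, exists b, [/\ a < ratr q, ratr q < b, P s a & P s b].
  move=> s; have [Ss|] := pselect (S s); last by exists 0.
  have [a [b [ab Pa Pb]]] := SP _ Ss.
  have [q] := rat_in_itvoo ab; rewrite in_itv/= => /andP[aq qb].
  by exists q => _; exists a, b.
have lt_f s s' : S s -> S s' -> s < s' -> f s != f s'.
  move=> /hf[a [_ [a1 _ Pa _]]] /hf[_ [b [_ b1 _ Pb]]] ss'.
  apply/eqP => E; have := Pmono _ _ _ _ ss' Pa Pb.
  by rewrite leNgt (lt_trans a1)// E.
apply/countable_injP; exists (pickle \o f) => s s'; rewrite !inE => Ss Ss' /= E.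
have {}E := pcan_inj pickleK E.
have [ss'|ss'|//] := ltgtP s s'.
- by move: (lt_f _ _ Ss Ss' ss'); rewrite E eqxx.
- by move: (lt_f _ _ Ss' Ss ss'); rewrite E eqxx.
Qed.

Context {n : nat}.
Variables (C : set 'rV[R]_n).
Hypothesis hC : pointed_cone C.
Variable K : set 'rV[R]_n.
Hypothesis psK : ps C K.
Local Notation normals := (normals_at_direction K).

(** Along a line parallel to the [i]-th axis the [i]-th coordinates of the supergradients of the concave
    function [1 / radial K] decrease, so that only countably many points of the line carry two values;
    Fubini concludes. *)
Lemma kinks_null i : sphere_measure (kinks C K i) = 0%E.
Proof.
apply: (sphere_measure_line (i := i)); first exact: measurable_kinks.
move=> x; pose y s : 'rV[R]_n := \row_j if j == i then s else x ord0 j.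
(* [P s a]: some supergradient at [y s] has [i]-th coordinate [a] *)
pose P s a := nbhs (y s) C /\ exists2 u, normals (y s) u &
  a = u ord0 i / (radial K (y s) * dot u (y s)).
apply: (@nonincreasing_multimap_countable _ P) => [s /= [ys]|s s' a a' ss'].
  have [ys0 _] := andP ys; have yi0 : 0 < (enorm (y s))^-1 by rewrite invr_gt0.
  move=> [[_ Cp] [u [u' [uv u'v uu']]]].
  have yE : y s = enorm (y s) *: sphere_proj (y s).
    by rewrite /sphere_proj scalerA mulfV ?gt_eqF// scale1r.
  have Cy : nbhs (y s) C by rewrite yE; exact: int_coneZ.
  have rE : radial K (sphere_proj (y s)) *: sphere_proj (y s) = radial K (y s) *: y s.
    by rewrite -(radial_homog hC psK Cp ys0) -yE.
  have rg := radial_gt0 hC psK Cy.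
  have nE w : normals (sphere_proj (y s)) w -> normals (y s) w.
    by rewrite /normals_at_direction rE.
  exists (u ord0 i / (radial K (y s) * dot u (y s))).
  exists (u' ord0 i / (radial K (y s) * dot u' (y s))); split.
  - rewrite !invfM !(mulrCA _ (radial K (y s))^-1) ltr_pM2l ?invr_gt0//.
    move: uu'; rewrite /slope {1 2}/sphere_proj !dotZr !invfM.
    by rewrite !(mulrCA _ (enorm (y s))^-1^-1) ltr_pM2l// invr_gt0.
  - by split => //; exists u => //; exact: nE.
  - by split => //; exists u' => //; exact: nE.
move=> [Cs [u uy ->]] [Cs' [u' uy' ->]].
have rs := radial_gt0 hC psK Cs; have rs' := radial_gt0 hC psK Cs'.
have us := normals_dot hC psK Cs uy; have us' := normals_dot hC psK Cs' uy'.
have ysE (w : 'rV[R]_n) : dot w (y s') = dot w (y s) + (s' - s) * w ord0 i.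
  rewrite -(dot_delta w) -dotZr -dotDr; congr (dot w _).
  apply/rowP => j; rewrite !mxE eqxx/=; case: eqP => _; last by rewrite mulr0 addr0.
  by rewrite mulr1 addrC subrK.
have [_ h] := uy; have := h _ (radial_mem hC psK Cs').
have [_ h'] := uy'; have := h' _ (radial_mem hC psK Cs).
rewrite !dotBl !dotZl !(dotC (y _)) !subr_le0.
set r := radial K (y s) in rs *; set r' := radial K (y s') in rs' *.
have e1 := ysE u; have e2 := ysE u'.
set d := dot u (y s) in us e1 *; set d' := dot u' (y s') in us' e2 *.
move: e1 e2; set m := dot u (y s'); set m' := dot u' (y s) => e1 e2 h1 h2.
have t0 : 0 < s' - s by rewrite subr_gt0.
have rd : r * d < 0 by rewrite pmulr_rlt0.
have rd' : r' * d' < 0 by rewrite pmulr_rlt0.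
apply: (@le_trans _ _ ((s' - s)^-1 * (r'^-1 - r^-1))).
  have -> : u' ord0 i = (s' - s)^-1 * (d' - m').
    by rewrite e2 [m' + _]addrC addrK mulKf// gt_eqF.
  rewrite -mulrA ler_pM2l ?invr_gt0// mulrBl.
  have -> : d' / (r' * d') = r'^-1 by rewrite [r' * d']mulrC invfM mulVKf// lt_eqF.
  by rewrite lerD2l lerN2 ler_ndivlMr// ler_pdivlMl.
have -> : u ord0 i = (s' - s)^-1 * (m - d).
  by rewrite e1 [d + _]addrC addrK mulKf// gt_eqF.
rewrite -mulrA ler_pM2l ?invr_gt0// mulrBl.
have -> : d / (r * d) = r^-1 by rewrite [r * d]mulrC invfM mulVKf// lt_eqF.
by rewrite lerD2r ler_ndivlMr// ler_pdivlMl.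
Qed.

(** All slopes together determine a normal vector up to a positive factor, and it is a unit vector. *)
Lemma unique_normal_outside_kinks v u u' : Omega C v -> normals v u -> normals v u' ->
  (forall i, ~ kinks C K i v) -> u = u'.
Proof.
move=> Ov uv u'v nk.
have du := normals_dot hC psK Ov.2 uv; have du' := normals_dot hC psK Ov.2 u'v.
have sl i : slope i v u = slope i v u'.
  apply/eqP; rewrite eq_le !leNgt; apply/andP; split; apply/negP => lt;
    apply: (nk i); split => //; [exists u', u|exists u, u']; split => //.
have uE : u = (dot u v / dot u' v) *: u'.
  apply/rowP => i; rewrite mxE; have := sl i; rewrite /slope => E.
  by rewrite mulrAC -mulrA -E mulrCA mulfV ?mulr1// lt_eqF.
have k0 : 0 < dot u v / dot u' v by rewrite ltr_ndivlMr// mul0r.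
have := normals_sphere uv; rewrite uE /sphere/= enormZ ?ltW//.
by rewrite (normals_sphere u'v) mulr1 => ->; rewrite scale1r.
Qed.

End kinks.

(** * Powers of the radial function as densities *)

Section density.
Context d (T : measurableType d) {R : realType}.
Variable mu : {measure set T -> \bar R}.
Variables (D : set T) (mD : measurable D) (f : T -> \bar R).
Hypotheses (mf : measurable_fun D f) (f0 : forall x, D x -> (0 <= f x)%E).
Local Open Scope ereal_scope.

Lemma density_measure : exists m : {measure set T -> \bar R},
  forall A, m A = \int[mu]_(x in D `&` A) f x.
Proof.
pose g (A : set T) := \int[mu]_(x in D `&` A) f x.
have g0 : g set0 = 0 by rewrite /g setI0 integral_set0.
have g_ge0 A : 0 <= g A by apply: integral_ge0 => x [Dx _]; exact: f0.
have gs : semi_sigma_additive g.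
  move=> F mF tF mUF; rewrite /g setI_bigcupr ge0_integral_bigcup//.
  - apply: is_cvg_nneseries => k _ _; exact: g_ge0.
  - by move=> k; exact: measurableI.
  - rewrite -setI_bigcupr; apply: measurable_funS mf => //; exact: subIsetl.
  - by move=> x [k _ [Dx _]]; exact: f0.
  - exact: trivIset_setIl.
pose m : {measure set T -> \bar R} := HB.pack g
  (isMeasure.Build d T R g g0 g_ge0 gs).
by exists m.
Qed.

End density.

Section radial_power.
Context {R : realType} {n : nat}.
Implicit Types (u x y z v : 'rV[R]_n).
Hypothesis n0 : (0 < n)%N.
Variables (C : set 'rV[R]_n).
Hypothesis hC : pointed_cone C.
Variable q : R.
Hypothesis q0 : q < 0.
Local Notation sigma := (@sphere_measure R n).
Local Notation Om := (Omega C : set (borel R n)).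

Lemma powR_neg_le (a b : R) : 0 < a -> a <= b -> b `^ q <= a `^ q.
Proof.
move=> a0 ab; have b0 : 0 < b := lt_le_trans a0 ab.
rewrite -(opprK q) !(powRN _ (- q)) lef_pV2 ?posrE ?powR_gt0//.
by apply: ge0_ler_powR => //; [rewrite oppr_ge0 ltW|rewrite nnegrE ltW..].
Qed.

Lemma measurable_radial K : ps C K -> measurable_fun Om (radial K : borel R n -> R).
Proof.
move=> psK mO; apply: (measurability _ (RGenOInfty.measurableE R)) => // _ [_ [a ->] <-].
have [a0|a0] := leP a 0.
  rewrite (_ : _ `&` _ = Om); first exact: measurable_Omega.
  apply/seteqP; split => [v []//|v Ov]; split => //=.
  by rewrite in_itv/= andbT; apply: le_lt_trans a0 _; exact: (radial_gt0 hC psK Ov.2).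
rewrite (_ : _ `&` _ = Om `&` ~` [set v | K (a *: v)]).
  apply: measurableI; first exact: measurable_Omega.
  apply: measurableC; apply: closed_borel.
  rewrite (_ : mkset _ = (fun x => a *: x) @^-1` K)//.
  by apply: closed_comp; [move=> x _; exact: scaler_continuous|exact: (ps_closed psK)].
apply/seteqP; split => v /= [Ov].
  rewrite in_itv/= andbT ltNge => /negP nle; split => // Ka; apply: nle.
  exact: (radial_le hC psK Ov.2).
move=> nK; split => //; rewrite in_itv/= andbT ltNge; apply/negP.
by move=> /(radial_leE hC psK Ov.2 a0).
Qed.

Lemma measurable_radial_pow K : ps C K ->
  measurable_fun Om (fun v : borel R n => (radial K v `^ q)%:E).
Proof.
move=> psK; apply/measurable_EFinP.
exact: (measurableT_comp (measurable_powR (R := R) q) (measurable_radial psK)).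
Qed.

(** The boundary point in a unit direction [v] has max norm at most [radial K v]. *)
Lemma radial_lower_bound K (d : R) v : ps C K -> (forall x, `|x| < d -> ~ K x) ->
  Omega C v -> d <= radial K v.
Proof.
move=> psK dK [sv Cv]; rewrite leNgt; apply/negP => rd.
apply: (dK (radial K v *: v)) (radial_mem hC psK Cv).
rewrite normrZ gtr0_norm ?(radial_gt0 hC psK Cv)//; apply: le_lt_trans rd.
by apply: ler_piMr; [exact: ltW (radial_gt0 hC psK Cv)|exact: sphere_norm_le1].
Qed.

Lemma ps_away K : ps C K -> exists2 d : R, 0 < d & forall x, `|x| < d -> ~ K x.
Proof.
move=> psK; have : nbhs (0 : 'rV[R]_n) (~` K).
  apply: open_nbhs_nbhs; split; first by rewrite openC; exact: (ps_closed psK).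
  by case: psK => _ [].
move=> /nbhs_ballP[d /= d0 dK]; exists d => // x xd; apply: dK.
by rewrite -ball_normE /ball_/= sub0r normrN.
Qed.

Lemma sphere_measure_Omega_fin : (sigma Om < +oo)%E.
Proof.
apply: le_lt_trans (@sphere_measure_fin R n).
by apply: le_measure; rewrite ?inE//; exact: measurable_Omega.
Qed.

Definition pow_integral K := (\int[sigma]_(v in Om) (radial K v `^ q)%:E)%E.

Lemma pow_integral_le K (d : R) : 0 < d -> ps C K -> (forall x, `|x| < d -> ~ K x) ->
  (pow_integral K <= (d `^ q)%:E * sigma Om)%E.
Proof.
move=> d0 psK dK; rewrite -integral_cst; last exact: measurable_Omega.
apply: ge0_le_integral => //.
- exact: measurable_Omega.
- by move=> v Ov; rewrite lee_fin powR_ge0.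
- exact: measurable_radial_pow.
- by move=> v Ov; rewrite lee_fin powR_neg_le//; exact: radial_lower_bound.
Qed.

Lemma pow_integral_fin K : ps C K -> (pow_integral K < +oo)%E.
Proof.
move=> psK; have [d d0 dK] := ps_away psK.
apply: le_lt_trans (pow_integral_le d0 psK dK) _.
by rewrite lte_mul_pinfty ?lee_fin ?powR_ge0//; exact: sphere_measure_Omega_fin.
Qed.

(** The density is positive on [Omega C], which has positive measure. *)
Lemma pow_integral_gt0 K : ps C K -> (0 < pow_integral K)%E.
Proof.
move=> psK; rewrite lt0e integral_ge0 ?andbT; last first.
  by move=> v _; rewrite lee_fin powR_ge0.
apply/eqP => V0.
have h : ae_eq sigma Om (fun v : borel R n => (radial K v `^ q)%:E) (cst 0%E).
  apply/ae_eq_integral_abs; [exact: measurable_Omega|exact: measurable_radial_pow|].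
  rewrite -[RHS]V0; apply: eq_integral => v _.
  by rewrite gee0_abs// lee_fin powR_ge0.
have := sphere_measure_gt0 n0 hC (measurable_Omega C); rewrite lt0e => /andP[/eqP + _]; apply.
have [N [mN N0 hN]] := h.
apply/eqP; rewrite -measure_le0 -N0; apply: le_measure; rewrite ?inE//.
  exact: measurable_Omega.
move=> v Ov; apply: hN => /= /(_ Ov) /eqP; rewrite eqe gt_eqF//.
by apply: powR_gt0; exact: (radial_gt0 hC psK Ov.2).
Qed.

Definition pow_int K : R := fine (pow_integral K).

Lemma pow_int_ge0 K : 0 <= pow_int K.
Proof. by apply: fine_ge0; apply: integral_ge0 => v _; rewrite lee_fin powR_ge0. Qed.

Lemma pow_intE K : ps C K -> pow_integral K = (pow_int K)%:E.
Proof.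
move=> psK; rewrite /pow_int fineK// ge0_fin_numE; first exact: pow_integral_fin.
by apply: integral_ge0 => v _; rewrite lee_fin powR_ge0.
Qed.

Lemma pow_int_gt0 K : ps C K -> 0 < pow_int K.
Proof. by move=> psK; have := pow_integral_gt0 psK; rewrite pow_intE// lte_fin. Qed.

Lemma pow_int_scale K (s : R) : ps C K -> 0 < s ->
  pow_int [set x | K (s^-1 *: x)] = s `^ q * pow_int K.
Proof.
move=> psK s0; apply: EFin_inj; rewrite EFinM.
transitivity (pow_integral [set x | K (s^-1 *: x)]).
  exact/esym/pow_intE/(ps_scale hC psK s0).
transitivity ((s `^ q)%:E * pow_integral K)%E; last by congr (_ * _)%E; exact: pow_intE.
rewrite /pow_integral -ge0_integralZl//=; last 4 first.
- exact: measurable_Omega.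
- exact: measurable_radial_pow.
- by move=> v _; rewrite lee_fin powR_ge0.
- by rewrite lee_fin powR_ge0.
apply: eq_integral => v; rewrite inE => Ov; have rg := radial_gt0 hC psK Ov.2.
by rewrite (radial_scale hC psK Ov.2 s0) powRM ?ltW.
Qed.

End radial_power.

(** * First variation along Wulff shapes *)

Section variation.
Context {R : realType} {n : nat}.
Implicit Types (u x y z v : 'rV[R]_n).
Variables (C : set 'rV[R]_n).
Hypothesis hC : pointed_cone C.
Variable q : R.
Hypothesis q0 : q < 0.
Variables (K F : set 'rV[R]_n).
Hypothesis psK : ps C K.
Hypothesis cF : closed F.
Hypothesis FU : forall u, F u -> sphere u /\ dual_cone C u.
Local Notation sigma := (@sphere_measure R n).
Local Notation Om := (Omega C : set (borel R n)).

(** The Wulff shape of the support function of [K] multiplied by [lam] on [F]; [s] ranges over the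
    lower bounds of [- dot u y], so that [s] may be read as minus the support function of [K]. *)
Definition wulff (lam : R) : set 'rV[R]_n := [set x | K x /\
  forall u s, F u -> (forall y, K y -> s <= - dot u y) -> lam * s <= - dot u x].

Lemma wulff_scale lam x : 1 <= lam -> K x -> wulff lam (lam *: x).
Proof.
move=> lam1 Kx; have l0 : 0 <= lam by exact: le_trans lam1.
split=> [|u s Fu hs].
  rewrite -(subrK x (lam *: x)) addrC; apply: (ps_shift psK Kx).
  rewrite -{2}(scale1r x) -scalerBl; apply: coneZ => //; first by rewrite subr_ge0.
  exact: (ps_sub psK).
by rewrite dotZr -mulrN; apply: ler_wpM2l => //; exact: hs.
Qed.

Lemma wulff_ps lam : 1 <= lam -> ps C (wulff lam).
Proof.
move=> lam1; have [[[x Kx] cK /convexP coK] [KC K0 _]] := psK.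
apply: ps_intro => //.
- by exists (lam *: x); exact: wulff_scale.
- rewrite (_ : wulff lam = K `&` \bigcap_(us in [set us : 'rV[R]_n * R |
      F us.1 /\ (forall y, K y -> us.2 <= - dot us.1 y)])
      [set x | lam * us.2 <= - dot us.1 x]); last first.
    apply/seteqP; split => [y [Ky hy]|y [Ky hy]]; split => //.
      by move=> [u s] /= [Fu hs]; exact: hy.
    by move=> u s Fu hs; exact: (hy (u, s)).
  apply: closedI => //; apply: closed_bigI => us _.
  rewrite (_ : mkset _ = (fun x => - dot us.1 x) @^-1` [set r | lam * us.2 <= r])//.
  apply: closed_comp => [y _|]; last exact: closed_ge.
  by apply: continuousN; exact: dot_continuous.
- apply/convexP => y z t t01 [Ky hy] [Kz hz]; split; first exact: coK.
  move=> u s Fu hs; have /andP[t0 t1] := t01.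
  have t1' : 0 <= 1 - t by rewrite subr_ge0 ltW.
  rewrite dotDr !dotZr opprD -!mulrN.
  have := lerD (ler_wpM2l (ltW t0) (hy _ _ Fu hs)) (ler_wpM2l t1' (hz _ _ Fu hs)).
  by rewrite -mulrDl [t + _]addrC subrK mul1r.
- by move=> y [/KC].
- by move=> [/K0].
- move=> y z [Ky hy] Cz; split; first exact: (ps_shift psK).
  move=> u s Fu hs; rewrite dotDr opprD; apply: le_trans (hy _ _ Fu hs) _.
  by rewrite lerDl oppr_ge0; exact: (FU Fu).2.
Qed.

Lemma wulff_sub lam : wulff lam `<=` K. Proof. by move=> x []. Qed.

Lemma wulff_mono l1 l2 : 0 < l1 -> l1 <= l2 -> wulff l2 `<=` wulff l1.
Proof.
move=> l0 l12 x [Kx hx]; split => // u s Fu hs.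
have [s0|s0] := leP 0 s.
  by apply: le_trans (hx _ _ Fu hs); exact: ler_wpM2r.
apply: (@le_trans _ _ 0); first by rewrite pmulr_rle0// ltW.
by rewrite oppr_ge0; apply: (FU Fu).2; exact: (ps_sub psK).
Qed.

Section radial.
Variables (lam : R) (lam1 : 1 <= lam).

Lemma radial_wulff_ge v : nbhs v C -> radial K v <= radial (wulff lam) v.
Proof.
move=> Cv; apply: (radial_subset hC psK (wulff_ps lam1)) => //; exact: wulff_sub.
Qed.

Lemma radial_wulff_le v : nbhs v C -> radial (wulff lam) v <= lam * radial K v.
Proof.
move=> Cv; have rg := radial_gt0 hC psK Cv.
apply: (radial_le hC (wulff_ps lam1) Cv).
  by rewrite mulr_gt0//; exact: lt_le_trans lam1.
by rewrite -scalerA; apply: wulff_scale => //; exact: (radial_mem hC psK Cv).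
Qed.

Definition moved := [set v | Omega C v /\ radial K v < radial (wulff lam) v].

Lemma measurable_moved : measurable (moved : set (borel R n)).
Proof.
rewrite (_ : moved = Om `&` (fun v : borel R n => radial (wulff lam) v - radial K v) @^-1` `]0, +oo[%classic).
  apply: (@measurable_funB _ _ _ Om) => //.
  - exact: (measurable_radial hC (wulff_ps lam1)).
  - exact: (measurable_radial hC psK).
  - exact: measurable_Omega.
by apply/seteqP; split => v [Ov h]; split => //; move: h; rewrite /= in_itv/= andbT subr_gt0.
Qed.

End radial.

(** If no normal vector at the boundary point in direction [v] lies in the compact set [F], then
    that point stays in the Wulff shape for [lam] close to 1. *)
Lemma not_moved v : Omega C v -> (forall u, F u -> ~ normals_at_direction K v u) ->
  \forall lam \near (1 : R), wulff lam (radial K v *: v).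
Proof.
move=> [sv Cv] nF; set x := radial K v *: v.
have Kx : K x by exact: (radial_mem hC psK Cv).
have cptF : compact F.
  apply: (subclosed_compact cF compact_sphere) => u /FU[]; exact.
pose P (lam : R) u := exists2 y, K y & 0 < dot (lam *: y - x) u.
have : \forall lam \near (1 : R), F `<=` P lam.
  apply: ((compact_near_coveringP _).1 cptF _ (nbhs (1 : R)) P) => u Fu.
  have /not_andP[] := nF _ Fu; first by case; exact: (FU Fu).1.
  move=> /existsNP[y /not_implyP[Ky /negP]]; rewrite -ltNge => h.
  have cv : (fun p : 'rV[R]_n * R => dot (p.2 *: y - x) p.1) @ (u, (1 : R)) -->
      dot ((1 : R) *: y - x) u.
    apply: cvg_dot; last exact: cvg_fst.
    apply: cvgB; last exact: cvg_cst.
    by apply: cvg_scale1; exact: cvg_snd.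
  have := cv [set r | 0 < r]; rewrite scale1r.
  move=> /(_ (open_nbhs_nbhs (conj (@open_gt R 0) h))).
  by apply: (@filterS _ (nbhs (u, (1 : R)))) => -[u' l] /= h'; exists y.
move=> near1; near=> lam.
have l0 : 0 < lam by near: lam; exact: lt_nbhsr.
have hP : F `<=` P lam by near: lam.
split => // u s Fu hs; have [y Ky] := hP _ Fu.
rewrite dotBl dotZl subr_gt0 => h; rewrite dotC lerNr; apply/ltW.
apply: lt_le_trans h _; rewrite -mulrN ler_pM2l// dotC lerNr; exact: hs.
Unshelve. all: by end_near. Qed.

Local Notation V := (pow_int C q).

(** Bernoulli's inequality for real exponents in the unit interval. *)
Lemma powR_le_affine (L m : R) : 0 < L -> 0 <= m <= 1 -> L `^ m <= 1 - m + m * L.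
Proof.
move=> L0 /andP[m0 m1]; rewrite /powR gt_eqF//.
have := @convex_expR R (Itv01 m0 m1) (ln L) 0.
rewrite !convRE/= mulr0 addr0 expR0 lnK ?posrE// mulr1 => /le_trans; apply.
by rewrite addrC.
Qed.

Let powR_itv01 (lam : R) : 1 < lam -> 0 < lam `^ q < 1.
Proof.
move=> l1; have l0 : 0 < lam by exact: lt_trans l1.
rewrite powR_gt0//= /powR gt_eqF// -expR0 ltr_expR nmulr_rlt0//; exact: ln_gt0.
Qed.

Let sub_EFin (a v : R) (y : \bar R) : (a%:E + y)%E = v%:E -> y = (v - a)%:E.
Proof. by move=> h; rewrite EFinB -h [X in _ = (X - _)%E]addeC addeK. Qed.

(** After the affine bound on [L `^ m], the positive factor [1 - L] cancels. *)
Let share_le (L a v w m : R) : 0 <= v -> 0 < L < 1 -> 0 <= m <= 1 ->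
  L * a + (v - a) <= w -> w <= v * L `^ m -> m * v <= a.
Proof.
move=> v0 /andP[L0 L1] m01 h h2.
have h3 := le_trans (le_trans h h2) (ler_wpM2l v0 (powR_le_affine L0 m01)).
rewrite -(@ler_pM2r _ (1 - L)) ?subr_gt0//.
have : 0 <= v * (1 - m + m * L) - (L * a + (v - a)) by rewrite subr_ge0.
rewrite -subr_ge0; congr (0 <= _); ring.
Qed.

Section optimal.
Variable m : R.
Hypothesis m01 : 0 <= m <= 1.
Hypothesis opt : forall lam, 1 < lam -> V (wulff lam) <= V K * lam `^ (q * m).

Variable nu : {measure set (borel R n) -> \bar R}.
Hypothesis nuE : forall A, nu A = (\int[sigma]_(v in Om `&` A) (radial K v `^ q)%:E)%E.

(** On the moved directions the radial function grows at most by the factor [lam], and elsewhere it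
    does not change, so [V (wulff lam) >= V K - (1 - lam ^ q) nu (moved lam)]. Optimality and
    Bernoulli's inequality with [L = lam ^ q] give
    [V (wulff lam) <= V K * L ^ m <= V K * (1 - m (1 - L))]; dividing by [1 - L > 0] yields the claim,
    without any differentiation. *)
Lemma nu_moved lam : 1 < lam -> ((m * V K)%:E <= nu (moved lam))%E.
Proof.
move=> l1; have l1' := ltW l1; have l0 : 0 < lam by exact: lt_trans l1.
have psW := wulff_ps l1'.
have mO := measurable_Omega C.
have mA : measurable (moved lam : set (borel R n)) by exact: measurable_moved.
pose A : set (borel R n) := moved lam; pose B : set (borel R n) := Om `\` A.
have mB : measurable B by exact: measurableD.
have AO : A `<=` Om by move=> v [].
have ABO : A `|` B = Om by rewrite setDUK.
have disAB : [disjoint A & B] by rewrite disj_set2E setDIK.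
have mK : measurable_fun Om (fun v : borel R n => (radial K v `^ q)%:E).
  exact: measurable_radial_pow.
have mW : measurable_fun Om (fun v : borel R n => (radial (wulff lam) v `^ q)%:E).
  exact: measurable_radial_pow.
have pos (L : set 'rV[R]_n) (v : borel R n) : (0 <= (radial L v `^ q)%:E)%E.
  by rewrite lee_fin powR_ge0.
have split_int (f : borel R n -> \bar R) : measurable_fun Om f -> (forall v, (0 <= f v)%E) ->
    (\int[sigma]_(v in A) f v + \int[sigma]_(v in B) f v = \int[sigma]_(v in Om) f v)%E.
  move=> mf f0; rewrite -[in RHS]ABO; apply/esym; apply: ge0_integral_setU => //.
  by rewrite ABO.
have EK : (\int[sigma]_(v in A) (radial K v `^ q)%:E + \int[sigma]_(v in B) (radial K v `^ q)%:E)%E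
    = (V K)%:E.
  by rewrite -(pow_intE hC q0 psK); exact: split_int mK (pos K).
have EW : (\int[sigma]_(v in A) (radial (wulff lam) v `^ q)%:E +
    \int[sigma]_(v in B) (radial (wulff lam) v `^ q)%:E)%E = (V (wulff lam))%:E.
  by rewrite -(pow_intE hC q0 psW); exact: split_int mW (pos _).
have nuA : nu A = (\int[sigma]_(v in A) (radial K v `^ q)%:E)%E.
  by rewrite nuE setIidr.
rewrite -/A.
have nuAfin : nu A \is a fin_num.
  rewrite ge0_fin_numE// nuA; apply: (@le_lt_trans _ _ (V K)%:E); last exact: ltry.
  by rewrite -EK leeDl//; apply: integral_ge0 => v _; exact: pos.
have WA : ((lam `^ q)%:E * nu A <= \int[sigma]_(v in A) (radial (wulff lam) v `^ q)%:E)%E.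
  rewrite nuA -ge0_integralZl//=; last 2 first.
  - exact: measurable_funS mK.
  - by rewrite lee_fin powR_ge0.
  apply: ge0_le_integral => //.
  - by move=> v _; rewrite -EFinM lee_fin mulr_ge0 ?powR_ge0.
  - apply: measurable_funeM; exact: measurable_funS mK.
  - exact: measurable_funS mW.
  - move=> v [[_ Cv] _]; rewrite -EFinM lee_fin.
    have rg := radial_gt0 hC psK Cv.
    rewrite -(powRM _ (ltW l0) (ltW rg)); apply: powR_neg_le => //.
      exact: (radial_gt0 hC psW Cv).
    exact: radial_wulff_le.
have WB : (\int[sigma]_(v in B) (radial K v `^ q)%:E =
    \int[sigma]_(v in B) (radial (wulff lam) v `^ q)%:E)%E.
  apply: eq_integral => v; rewrite inE => -[Ov nA]; congr (_ `^ q)%:E.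
  apply: le_anti; apply/andP; split; first exact: (radial_wulff_ge l1' Ov.2).
  by rewrite leNgt; apply/negP => h; exact: nA.
have [a aE] : exists a : R, nu A = a%:E by exists (fine (nu A)); rewrite fineK.
have BE : (\int[sigma]_(v in B) (radial K v `^ q)%:E = (V K - a)%:E)%E.
  by apply: sub_EFin; rewrite -EK -aE nuA.
move: WA EW; rewrite -WB BE aE -EFinM => WA EW.
have : ((lam `^ q * a + (V K - a))%:E <= (V (wulff lam))%:E)%E.
  by rewrite -EW EFinD leeD2r.
rewrite !lee_fin => h.
have L01 := powR_itv01 l1.
have := opt l1; rewrite powRrM.
exact: (share_le (pow_int_ge0 C q K) L01 m01 h).
Qed.

(** Let [lam] decrease to 1: a direction moved for every [lam > 1] has a normal vector in [F]. *)
Lemma nu_normals :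
  ((m * V K)%:E <= nu [set v | Om v /\ exists2 u, normals_at_direction K v u & F u])%E.
Proof.
pose A k : set (borel R n) := moved (1 + k.+1%:R^-1).
have l1 k : 1 < 1 + k.+1%:R^-1 :> R by rewrite ltrDl invr_gt0.
have mA k : measurable (A k) by apply: measurable_moved; exact/ltW/l1.
have nuO : (nu Om < +oo)%E.
  rewrite nuE setIid; exact: (pow_integral_fin hC q0 psK).
have cvgA : nu \o A @ \oo --> nu (\bigcap_k A k).
  apply: nonincreasing_cvg_mu => //.
  - apply: le_lt_trans nuO; apply: le_measure; rewrite ?inE//.
      exact: measurable_Omega.
    by move=> v [].
  - exact: bigcapT_measurable.
  - apply/nonincreasing_seqP => k; apply/subsetPset => v [Ov h]; split => //.
    apply: lt_le_trans h _; apply: (radial_subset hC (wulff_ps _) (wulff_ps _)) Ov.2;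
      try exact/ltW/l1.
    apply: wulff_mono; first by apply: lt_trans (l1 _).
    by rewrite lerD2l lef_pV2 ?posrE// ler_nat.
apply: (@le_trans _ _ (nu (\bigcap_k A k))).
  rewrite -(cvg_lim _ cvgA)//; apply: lime_ge; first by apply/cvg_ex; eexists; exact: cvgA.
  by apply: nearW => k; exact: nu_moved.
apply: le_measure; rewrite ?inE.
- exact: bigcapT_measurable.
- exact: measurable_normals_in.
move=> v Av; have Ov : Omega C v by have [] := Av 0%N I.
split => //; apply: contrapT => nF.
have : \forall lam \near (1 : R), wulff lam (radial K v *: v).
  by apply: not_moved => // u Fu uv; apply: nF; exists u.
move=> /nbhs_ballP[d /= d0 dW].
have [k _ /(_ k (leqnn k)) kd] := near_infty_natSinv_lt (PosNum d0).
have := dW (1 + k.+1%:R^-1).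
rewrite /ball/= opprD addrA subrr sub0r normrN gtr0_norm ?invr_gt0// => /(_ kd) hW.
have [_] := Av k I; rewrite ltNge => /negP; apply.
by apply: (radial_le hC (wulff_ps (ltW (l1 k))) Ov.2) => //; exact: (radial_gt0 hC psK Ov.2).
Qed.

End optimal.
End variation.

(** * The logarithmic functional and its minimizer *)

Section limits.
Context {R : realType}.

Lemma limn_einf_ge (u : (\bar R)^nat) (a : \bar R) :
  (\forall i \near \oo, (a <= u i)%E) -> (a <= limn_einf u)%E.
Proof.
move=> [N _ Nu]; rewrite limn_einf_lim; apply: lime_ge; first exact: is_cvg_einfs.
near=> i; apply: le_ereal_inf_tmp => _ [k /= ik <-]; apply: Nu => /=.
by apply: leq_trans ik; near: i; exact: nbhs_infty_ge.
Unshelve. all: by end_near. Qed.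

Lemma limn_einf_le (u w : (\bar R)^nat) (l : \bar R) :
  (forall i, (u i <= w i)%E) -> w @ \oo --> l -> (limn_einf u <= l)%E.
Proof.
move=> uw wl; rewrite limn_einf_lim -(cvg_lim _ wl)//; apply: lee_lim.
- exact: is_cvg_einfs.
- by apply/cvg_ex; exists l.
- apply: nearW => i; apply: le_trans (uw i); apply: ereal_inf_lbound.
  by exists i => /=.
Qed.

Lemma cvg_powR (u : R^nat) (l q : R) : (forall i, 0 < u i) -> 0 < l ->
  u @ \oo --> l -> (fun i => u i `^ q) @ \oo --> l `^ q.
Proof.
move=> u0 l0 ul.
rewrite (_ : (fun i => u i `^ q) = (fun i => expR (q * ln (u i)))); last first.
  by apply/funext => i; rewrite /powR gt_eqF.
rewrite /powR gt_eqF//; apply: (cvg_comp (fun i => q * ln (u i)) expR); last exact: continuous_expR.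
apply: cvgM; first exact: cvg_cst.
exact: (continuous_cvg _ (continuous_ln l0) ul).
Qed.

Lemma cvg_EFin_eq (f : (\bar R)^nat) (g : R^nat) (l : \bar R) (r : R) :
  (forall i, f i = (g i)%:E) -> l = r%:E -> f @ \oo --> l -> g @ \oo --> r.
Proof.
move=> fg ->; rewrite (_ : f = EFin \o g); last by apply/funext => i; rewrite fg.
by move/fine_cvgP => [_].
Qed.

End limits.

Section functional.
Context {R : realType} {n : nat}.
Implicit Types (u x y z v : 'rV[R]_n) (K L F : set 'rV[R]_n).
Hypothesis n0 : (0 < n)%N.
Variables (C : set 'rV[R]_n).
Hypothesis hC : pointed_cone C.
Variable q : R.
Hypothesis q0 : q < 0.
Variable phi : {finite_measure set (borel R n) -> \bar R}.
Variable e : 'rV[R]_n.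
Hypothesis Ce : nbhs e C.
Local Notation sigma := (@sphere_measure R n).
Local Notation Om := (Omega C : set (borel R n)).
Local Notation U := (cl_Omega_dual C : set (borel R n)).
Local Notation V := (pow_int C q).
Hypothesis e_small : forall u, U u -> - dot u e <= 1.
Hypothesis phiU : phi U <> 0%E.

Lemma U_dot_gt0 u x : U u -> nbhs x C -> 0 < - dot u x.
Proof. by move=> /(cl_Omega_dual_sub)[su du]; exact: (int_cone_dot_gt0 su du). Qed.

Lemma measurable_U : measurable U.
Proof. by apply: closed_borel; exact: closed_cl_Omega_dual. Qed.

(** Minus the logarithm of minus the support function of [K]; points on the boundary of the cone
    are left out so that only logarithms of positive numbers occur, and the value is +oo where
    the support function vanishes. *)
Definition neg_log_support (K : set 'rV[R]_n) (u : 'rV[R]_n) : \bar R :=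
  ereal_sup [set (- ln (- dot u x))%:E | x in K `&` [set x | nbhs x C]].
Local Notation ell := neg_log_support.

Lemma neg_log_support_ge K u x : K x -> nbhs x C -> ((- ln (- dot u x))%:E <= ell K u)%E.
Proof. by move=> Kx Cx; apply: ereal_sup_ubound; exists x. Qed.

Lemma measurable_neg_log_support K : measurable_fun U (ell K : borel R n -> \bar R).
Proof.
move=> mU; apply: (measurability _ (ErealGenOInfty.measurableE R)) => // _ [_ [a ->] <-].
pose O := \bigcup_(x in K `&` [set x | nbhs x C]) [set u | - dot u x < expR (- a)].
rewrite (_ : _ `&` _ = U `&` (O : set (borel R n))).
  apply: measurableI => //; apply: open_borel; apply: bigcup_open => x _.
  rewrite (_ : mkset _ = (fun u => - dot x u) @^-1` [set r | r < expR (- a)]).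
    apply: open_comp => [u _|]; last exact: open_lt.
    by apply: continuousN; exact: dot_continuous.
  by apply/seteqP; split => u /=; rewrite dotC.
have h u x : U u -> nbhs x C -> (a < - ln (- dot u x)) = (- dot u x < expR (- a)).
  move=> Uu Cx; have c0 := U_dot_gt0 Uu Cx.
  by rewrite ltrNr -{2}(lnK c0) ltr_expR.
apply/seteqP; split => u /= [Uu].
  rewrite in_itv/= andbT => /ereal_sup_gt[_ [x [Kx Cx] <-]]; rewrite lte_fin => ax.
  by split => //; exists x => //=; rewrite -h.
move=> [x [Kx Cx] /= ax]; split => //; rewrite in_itv/= andbT.
apply: lt_le_trans (neg_log_support_ge u Kx Cx).
by rewrite lte_fin h.
Qed.

Local Notation normal := (normalized C e).

Lemma neg_log_support_ge0 K u : normal K -> U u -> (0 <= ell K u)%E.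
Proof.
move=> nK Uu; apply: le_trans (neg_log_support_ge u (normalized_mem hC Ce nK) Ce).
by rewrite lee_fin oppr_ge0; apply: ln_le0; exact: e_small.
Qed.

Lemma neg_log_support_sub K L u : L `<=` K -> (ell L u <= ell K u)%E.
Proof.
move=> LK; apply: ereal_sup_le => _ [x [Lx Cx] <-].
by exists x => //; split => //; exact: LK.
Qed.

Lemma neg_log_support_scale K (t : R) u : 0 < t -> U u ->
  (ell [set x | K (t^-1 *: x)] u <= ell K u + (- ln t)%:E)%E.
Proof.
move=> t0 Uu; apply: ge_ereal_sup => _ [x [Kx Cx] <-].
have ti : 0 < t^-1 by rewrite invr_gt0.
have Cx' : nbhs (t^-1 *: x) C by exact: int_coneZ.
have c0 := U_dot_gt0 Uu Cx'.
have Kx' : K (t^-1 *: x) := Kx.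
have h := neg_log_support_ge u Kx' Cx'.
apply: (le_trans _ (leeD h (lexx (- ln t)%:E))).
rewrite -EFinD lee_fin -opprD -lnM ?posrE//.
by rewrite dotZr -mulrN mulrAC mulVf ?gt_eqF// mul1r.
Qed.

(** On [F] the Wulff shape has been cut so that minus its support function is at least [lam] times
    that of [K]; this is that inequality after taking [- ln]. *)
Lemma neg_log_support_wulff K F (lam : R) u : ps C K -> 0 < lam -> F u -> U u ->
  (ell (wulff K F lam) u + (ln lam)%:E <= ell K u)%E.
Proof.
move=> psK l0 Fu Uu; rewrite -leeBrDr//; apply: ge_ereal_sup => _ [x [[Kx hx] Cx] <-].
have c0 := U_dot_gt0 Uu Cx.
rewrite leeBrDr// -EFinD.
have := neg_log_support_ge u Kx Cx.
case Eell : (ell K u) => [a| |] // _; last by rewrite leey.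
(* the bound holds in the interior of the cone by definition of the supremum; boundary points [y]
   are limits of the interior points [y + e / k] *)
have lb y : K y -> expR (- a) <= - dot u y.
  move=> Ky.
  have cv : (fun k : nat => - dot u (y + k.+1%:R^-1 *: e)) @ \oo --> - dot u (y + (0 : R) *: e).
    apply: cvgN; apply: cvg_dot; first exact: cvg_cst.
    by apply: cvgD; [exact: cvg_cst|apply: cvg_scale1; exact: cvg_harmonic].
  move: cv; rewrite scale0r addr0 => cv.
  rewrite -(cvg_lim (@Rhausdorff R) cv); apply: limr_ge; first by apply/cvg_ex; eexists; exact: cv.
  apply: nearW => k.
  have k0 : 0 < k.+1%:R^-1 :> R by rewrite invr_gt0.
  have Ck : nbhs (y + k.+1%:R^-1 *: e) C.
    by rewrite addrC; apply: (int_coneDl hC (int_coneZ hC k0 Ce)); exact: (ps_sub psK).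
  have Kk : K (y + k.+1%:R^-1 *: e).
    exact: (ps_shift psK Ky (coneZ hC (ltW k0) (nbhs_singleton Ce))).
  have := neg_log_support_ge u Kk Ck; rewrite Eell lee_fin lerNl => h.
  by rewrite -[leRHS](lnK (U_dot_gt0 Uu Ck)) ler_expR.
have := hx _ _ Fu lb; rewrite -{1}(lnK l0) -expRD -{1}(lnK c0) ler_expR => h.
by rewrite lee_fin; lra.
Qed.

Definition support_energy K : \bar R := (\int[phi]_(u in U) ell K u)%E.
Local Notation E := support_energy.

Definition mass : R := fine (phi U).

Lemma massE : phi U = mass%:E.
Proof. by rewrite /mass fineK// fin_num_measure//; exact: measurable_U. Qed.

Lemma mass_gt0 : 0 < mass.
Proof.
rewrite -lte_fin -massE lt0e measure_ge0 andbT; exact/eqP.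
Qed.

(** Every dilation leaves this functional unchanged: the factor [mass / q] makes the change
    [q ln t] of [ln V] cancel the change [- mass * ln t] of the energy. *)
Definition objective K : \bar R := (E K + (mass / q * ln (V K))%:E)%E.

Lemma support_energy_ge0 K : normal K -> (0 <= E K)%E.
Proof. by move=> nK; apply: integral_ge0 => u Uu; exact: neg_log_support_ge0. Qed.

Lemma normalized_away : exists2 d : R, 0 < d & forall K, normal K -> forall x, `|x| < d -> ~ K x.
Proof.
have : nbhs (2^-1 *: e) C by apply: int_coneZ => //; rewrite invr_gt0.
move=> /nbhs_ballP[d /= d0 dC]; exists d => // K nK x xd.
apply: (normalized_half hC Ce nK); apply: dC.
by rewrite -ball_normE /ball_/= opprB addrC subrK.
Qed.

(** The energy is nonnegative, and [V] is bounded above because normalized pseudo-cones avoid a common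
    ball around the origin; [mass / q] is negative. *)
Lemma objective_bounded : exists L : R, forall K, normal K -> (L%:E <= objective K)%E.
Proof.
have [d d0 dK] := normalized_away.
pose S := fine (sigma Om).
have SE : sigma Om = S%:E.
  rewrite /S fineK// ge0_fin_numE//; exact: sphere_measure_Omega_fin.
have S0 : 0 < S by rewrite -lte_fin -SE; exact: (sphere_measure_gt0 n0 hC (measurable_Omega C)).
exists (mass / q * ln (d `^ q * S)) => K nK.
have [psK _] := nK.
rewrite -[leLHS]add0e; apply: leeD; first exact: support_energy_ge0.
rewrite lee_fin; apply: ler_wnM2l.
  by rewrite pmulr_rle0 ?mass_gt0// invr_le0 ltW.
have V0 := pow_int_gt0 n0 hC q0 psK.
rewrite ler_ln ?posrE//; last by rewrite mulr_gt0// powR_gt0.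
rewrite -lee_fin -(pow_intE hC q0 psK) EFinM -SE.
exact: (pow_integral_le hC q0 d0 psK (dK _ nK)).
Qed.

Lemma normalized_cone_shift : normal [set x | C (x - e)].
Proof.
have CN : ~ C (- e) := int_coneN hC n0 Ce.
have psK : ps C [set x | C (x - e)].
  apply: (ps_intro hC) => /=.
  - by exists e; rewrite /= subrr; exact: cone0.
  - rewrite (_ : mkset _ = (fun x => x - e) @^-1` C)//.
    apply: closed_comp => [x _|]; last exact: (cone_closed hC).
    exact: (cvgB (@cvg_id _ (nbhs x)) (cvg_cst e)).
  - have [_ /convexP cC _ _ _] := hC.
    apply/convexP => x y t t01 /= Cx Cy; have := cC _ _ _ t01 Cx Cy.
    rewrite !scalerBr addrACA -opprD -scalerDl.
    by rewrite [t + _]addrC subrK scale1r.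
  - move=> x /= Cx; rewrite -(subrK e x); apply: (coneD hC Cx).
    exact: nbhs_singleton Ce.
  - by rewrite sub0r.
  - by move=> x y Cx Cy; rewrite addrAC; exact: (coneD hC).
split => //; apply: radial_eq => //=.
  by rewrite scale1r subrr; exact: cone0.
move=> s s0; rewrite -{2}(scale1r e) -scalerBl => Cs.
rewrite leNgt; apply/negP => s1; apply: CN.
have s1' : 0 <= (1 - s)^-1 by rewrite invr_ge0 subr_ge0 ltW.
have := coneZ hC s1' Cs; rewrite scalerA -(opprB 1 s) mulrN mulVf ?scaleN1r//.
by rewrite subr_eq0 gt_eqF.
Qed.

(** For the translated cone, [- dot u x >= - dot u e] is bounded away from zero uniformly in [u]. *)
Lemma objective_cone_shift : (objective [set x | C (x - e)%R] < +oo)%E.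
Proof.
have [d d0 dU] := int_cone_dot Ce.
rewrite /objective lte_add_pinfty ?ltry//.
apply: (@le_lt_trans _ _ (\int[phi]_(u in U) (cst (- ln d)%:E u))%E); last first.
  have -> : (\int[phi]_(u in U) (cst (- ln d)%:E u) = (- ln d * mass)%:E)%E.
    transitivity ((- ln d)%:E * phi U)%E; first exact: (integral_cst phi measurable_U).
    by rewrite massE EFinM.
  exact: ltry.
apply: ge0_le_integral => //.
- exact: measurable_U.
- by move=> u Uu; apply: neg_log_support_ge0 => //; exact: normalized_cone_shift.
- exact: measurable_neg_log_support.
- move=> u Uu; have [su du] := cl_Omega_dual_sub Uu.
  apply: ge_ereal_sup => _ [x [Kx Cx] <-].
  rewrite lee_fin lerN2 ler_ln ?posrE//; last exact: U_dot_gt0.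
  apply: le_trans (dU _ su du) _; rewrite lerN2 -subr_le0 -dotBr.
  rewrite -oppr_ge0 -dotNr opprB -oppr_le0 -dotNr opprB.
  exact: du.
Qed.

(** Each point of the limit is approached by points [x + e / k] that eventually belong to the sets of
    the sequence, which bounds their supremum from below. *)
Lemma neg_log_support_lsc (K_ : nat -> set 'rV[R]_n) K u : U u ->
  (forall x y, K x -> nbhs (y - x) C -> \forall i \near \oo, K_ i y) ->
  (ell K u <= limn_einf (fun i => ell (K_ i) u))%E.
Proof.
move=> Uu hK; apply: ge_ereal_sup => _ [x [Kx Cx] <-].
have cv : (fun k : nat => (- ln (- dot u (x + k.+1%:R^-1 *: e)))%:E) @ \oo -->
    (- ln (- dot u x))%:E.
  apply: cvg_EFin; first exact: nearW.
  have c0 := U_dot_gt0 Uu Cx.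
  apply: cvgN; apply: (continuous_cvg _ (continuous_ln c0)).
  rewrite -[in X in _ --> X](addr0 x) -[in X in _ --> X](scale0r e).
  apply: cvgN; apply: cvg_dot; first exact: cvg_cst.
  by apply: cvgD; [exact: cvg_cst|apply: cvg_scale1; exact: cvg_harmonic].
rewrite -(cvg_lim _ cv)//; apply: lime_le; first by apply/cvg_ex; eexists; exact: cv.
apply: nearW => k; apply: limn_einf_ge.
have k0 : 0 < k.+1%:R^-1 :> R by rewrite invr_gt0.
have Ck : nbhs (x + k.+1%:R^-1 *: e - x) C.
  by rewrite addrC addKr; exact: int_coneZ.
have Ck' : nbhs (x + k.+1%:R^-1 *: e) C.
  by apply: (int_coneDl hC Cx); exact: (coneZ hC (ltW k0) (nbhs_singleton Ce)).
by have := hK _ _ Kx Ck; apply: filterS => i Ki; exact: neg_log_support_ge.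
Qed.

Lemma pow_int_cvg (K_ : nat -> set 'rV[R]_n) K : normal K -> (forall i, normal (K_ i)) ->
  (forall v, nbhs v C -> (fun i => radial (K_ i) v) @ \oo --> radial K v) ->
  (fun i => V (K_ i)) @ \oo --> V K.
Proof.
move=> nK nK_ rc; have [d d0 dK] := normalized_away.
have [psK _] := nK.
have psK_ i : ps C (K_ i) by have [] := nK_ i.
have mO := measurable_Omega C.
pose f i (v : borel R n) := (radial (K_ i) v `^ q)%:E.
pose f0 (v : borel R n) := (radial K v `^ q)%:E.
have fc : {ae sigma, forall v, Om v -> f ^~ v @ \oo --> f0 v}.
  apply: aeW => v [_ Cv]; apply: cvg_EFin; first exact: nearW.
  apply: cvg_powR; [|exact: (radial_gt0 hC psK Cv)|exact: rc].
  by move=> i; exact: (radial_gt0 hC (psK_ i) Cv).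
have gi : sigma.-integrable Om (cst (d `^ q)%:E).
  apply/integrableP; split => //.
  rewrite (eq_integral (cst (d `^ q)%:E)); last first.
    by move=> v _; rewrite gee0_abs// lee_fin powR_ge0.
  rewrite integral_cst// lte_mul_pinfty ?lee_fin ?powR_ge0//.
  exact: sphere_measure_Omega_fin.
have fg : {ae sigma, forall v i, Om v -> (`|f i v| <= cst (d `^ q)%:E v)%E}.
  apply: aeW => v i Ov; rewrite gee0_abs ?lee_fin ?powR_ge0//.
  by apply: powR_neg_le => //; apply: (radial_lower_bound hC (psK_ i) (dK _ (nK_ i)) Ov).
have [_ _ h] := dominated_convergence mO
  (fun i => measurable_radial_pow hC q (psK_ i)) (measurable_radial_pow hC q psK) fc gi fg.
apply: (cvg_EFin_eq _ _ h); last exact: (pow_intE hC q0 psK).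
by move=> i; exact: (pow_intE hC q0 (psK_ i)).
Qed.

(** The direct method: along a convergent subsequence of a minimizing sequence the energy is lower
    semicontinuous by Fatou's lemma, and [V] converges by dominated convergence. *)
Lemma minimizer_exists : exists2 K, normal K &
  (E K < +oo)%E /\ forall L, normal L -> (objective K <= objective L)%E.
Proof.
have [L hL] := objective_bounded.
pose S := [set objective K | K in [set K | normal K]].
have infS : ereal_inf S \is a fin_num.
  rewrite fin_numElt; apply/andP; split.
    apply: (@lt_le_trans _ _ L%:E); first exact: ltNyr.
    by apply: le_ereal_inf_tmp => _ [K nK <-]; exact: hL.
  apply: le_lt_trans objective_cone_shift; apply: ereal_inf_lbound.
  by eexists; [exact: normalized_cone_shift|].
have [m mE] : exists m : R, ereal_inf S = m%:E by exists (fine (ereal_inf S)); rewrite fineK.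
have /choice[K_ hK_] : forall i : nat, exists K, normal K /\
    (objective K < m%:E + (i.+1%:R^-1)%:E)%E.
  move=> i; have i0 : 0 < i.+1%:R^-1 :> R by rewrite invr_gt0.
  have [_ [K nK <-]] := lb_ereal_inf_adherent i0 infS.
  by rewrite mE; exists K.
have nK_ i : normal (K_ i) by have [] := hK_ i.
have [s [K [smono nK rc Kc]]] := normalized_compact hC Ce nK_.
have Vc := pow_int_cvg nK (fun i => nK_ (s i)) rc.
have V0 : 0 < V K by apply: (pow_int_gt0 n0 hC q0); case: nK.
have Elim : (E K <= (m - mass / q * ln (V K))%:E)%E.
  apply: (@le_trans _ _ (\int[phi]_(u in U) limn_einf (fun i => ell (K_ (s i)) u))%E).
    apply: ge0_le_integral.
    - exact: measurable_U.
    - by move=> u Uu; exact: neg_log_support_ge0.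
    - exact: measurable_neg_log_support.
    - have me i : measurable_fun U (fun u : borel R n => (- ell (K_ (s i)) u)%E).
        exact: (measurableT_comp (@oppe_measurable R setT) (@measurable_neg_log_support (K_ (s i)))).
      exact: (measurableT_comp (@oppe_measurable R setT) (measurable_fun_limn_esup me)).
    - by move=> u Uu; exact: neg_log_support_lsc.
  have ft := fatou phi measurable_U (fun i => @measurable_neg_log_support (K_ (s i)))
    (fun i u Uu => neg_log_support_ge0 (nK_ (s i)) Uu).
  apply: (le_trans ft).
  apply: (@limn_einf_le _ _ (fun i => (m + (s i).+1%:R^-1 - mass / q * ln (V (K_ (s i))))%:E)).
    move=> i; have [_ /ltW] := hK_ (s i).
    by rewrite /objective -leeBrDr// -EFinD -EFinB.
  apply: cvg_EFin; first exact: nearW.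
  apply: cvgB; last first.
    by apply: cvgM; [exact: cvg_cst|exact: (continuous_cvg _ (continuous_ln V0) Vc)].
  rewrite -[in X in _ --> X](addr0 m); apply: cvgD; first exact: cvg_cst.
  have sinf : s @ \oo --> \oo.
    have si i : (i <= s i)%N.
      by elim: i => // i IH; exact: leq_ltn_trans IH (smono _ _ (ltnSn i)).
    apply/cvgnyPge => N; near=> i; apply: leq_trans (si i).
    by near: i; exact: nbhs_infty_ge.
  exact: (cvg_comp s (fun k : nat => k.+1%:R^-1 : R) sinf (@cvg_harmonic R)).
exists K; first exact: nK.
split; first exact: (le_lt_trans Elim (ltry _)).
move=> L' nL'; apply: (@le_trans _ _ m%:E).
  by rewrite -leeBrDr// -EFinB; exact: Elim.
by rewrite -mE; apply: ereal_inf_lbound; exists L'.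
Unshelve. all: by end_near. Qed.

End functional.

(** * Optimality of the minimizer and comparison of measures *)

Section optimality.
Context {R : realType} {n : nat}.
Implicit Types (u x y z v : 'rV[R]_n) (K L F : set 'rV[R]_n).
Hypothesis n0 : (0 < n)%N.
Variables (C : set 'rV[R]_n).
Hypothesis hC : pointed_cone C.
Variable q : R.
Hypothesis q0 : q < 0.
Variable phi : {finite_measure set (borel R n) -> \bar R}.
Variable e : 'rV[R]_n.
Hypothesis Ce : nbhs e C.
Local Notation U := (cl_Omega_dual C : set (borel R n)).
Local Notation V := (pow_int C q).
Hypothesis e_small : forall u, U u -> - dot u e <= 1.
Hypothesis phiU : phi U <> 0%E.
Local Notation ell := (neg_log_support C).
Local Notation E := (support_energy C phi).
Local Notation M := (mass C phi).

(** The two terms in [ln r] cancel, and dividing by [m / q < 0] reverses the inequality. *)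
Let balance (a b f l m r v w : R) : 0 < m -> 0 < l -> 0 < r -> 0 < v -> 0 < w ->
  b + ln l * f <= a + ln r * m ->
  a + m / q * ln v <= b + m / q * ln (r^-1 `^ q * w) ->
  w <= v * l `^ (q * (f / m)).
Proof.
move=> m0 l0 r0 v0 w0 h1.
have q0' : q != 0 by rewrite lt_eqF.
rewrite lnM ?posrE ?powR_gt0 ?invr_gt0// ln_powR lnV ?posrE// => h2.
have h3 : m / q * (q * - ln r + ln w) = - (ln r * m) + m / q * ln w by field.
have h4 : m / q * ln v + ln l * f <= m / q * ln w by rewrite h3 in h2; lra.
rewrite -ler_ln ?posrE//; last by rewrite mulr_gt0 ?powR_gt0.
rewrite lnM ?posrE ?powR_gt0// ln_powR.
have mq : m / q < 0 by rewrite pmulr_rlt0// invr_lt0.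
rewrite -(ler_nM2l mq) mulrDr.
have -> : m / q * (q * (f / m) * ln l) = ln l * f by field; rewrite q0' gt_eqF.
exact: h4.
Qed.

(** The Wulff shape lowers the energy by at least [ln lam * phi F], so minimality forces [V] to
    decrease by the corresponding factor. The shape is renormalized by its radial function [r] in
    direction [e] before it is compared with the minimizer; the terms in [ln r] cancel. *)
Lemma minimizer_wulff K F (lam : R) : normalized C e K -> (E K < +oo)%E ->
  (forall L, normalized C e L -> (objective C q phi K <= objective C q phi L)%E) ->
  closed F -> F `<=` U -> 1 < lam ->
  V (wulff K F lam) <= V K * lam `^ (q * (fine (phi F) / M)).
Proof.
move=> nK Efin Kmin cF FU l1.
have l1' := ltW l1; have l0 : 0 < lam by exact: lt_trans l1.
have [psK re] := nK.
have FS u : F u -> sphere u /\ dual_cone C u by move=> /FU /(cl_Omega_dual_sub).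
set W := wulff K F lam.
have psW : ps C W by exact: wulff_ps.
pose r := radial W e.
have r0 : 0 < r by exact: (radial_gt0 hC psW Ce).
have r1 : 1 <= r by rewrite -re; exact: (radial_wulff_ge hC psK FS l1' Ce).
have ri : 0 < r^-1 by rewrite invr_gt0.
pose K' := [set x | W (r^-1^-1 *: x)].
have nK' : normalized C e K'.
  split; first exact: (ps_scale hC psW ri).
  by rewrite (radial_scale hC psW Ce ri) mulVf// gt_eqF.
have VK' : V K' = r^-1 `^ q * V W by exact: (pow_int_scale hC q0 psW ri).
have mF : measurable (F : set (borel R n)) by exact: closed_borel.
have mU : measurable U by exact: measurable_U.
have phiF : phi F = (fine (phi F))%:E by rewrite fineK// fin_num_measure.
have lnr : 0 <= ln r by exact: ln_ge0.
have lnl : 0 <= ln lam by exact: ln_ge0.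
have mell L : measurable_fun U (ell L : borel R n -> \bar R) by exact: measurable_neg_log_support.
have mind : measurable_fun U (fun u : borel R n => (ln lam)%:E * (\1_F u)%:E)%E.
  by apply: measurable_funeM; apply/measurable_EFinP; exact: measurable_indic.
have ptw u : U u -> (ell K' u + (ln lam)%:E * (\1_F u)%:E <= ell K u + (ln r)%:E)%E.
  move=> Uu.
  have h1 : (ell K' u <= ell W u + (ln r)%:E)%E.
    have := neg_log_support_scale hC W ri Uu.
    by rewrite lnV ?posrE// opprK.
  have h2 : (ell W u + (ln lam)%:E * (\1_F u)%:E <= ell K u)%E.
    rewrite indicE; have [Fu|Fu] := pselect (F u).
      by rewrite mem_set// mule1; exact: (neg_log_support_wulff hC Ce).
    by rewrite memNset// mule0 adde0; apply: neg_log_support_sub; exact: wulff_sub.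
  apply: (@le_trans _ _ (ell W u + (ln r)%:E + (ln lam)%:E * (\1_F u)%:E)%E).
    exact: leeD.
  by rewrite addeAC; exact: leeD.
have intI : (E K' + (ln lam * fine (phi F))%:E <= E K + (ln r * M)%:E)%E.
  have e1 : ((ln lam * fine (phi F))%:E = \int[phi]_(u in U) ((ln lam)%:E * (\1_F u)%:E))%E.
    rewrite ge0_integralZl//=.
    - rewrite integral_indic// (setIidl FU) EFinM; congr (_ * _)%E; exact/esym.
    - by apply/measurable_EFinP; exact: measurable_indic.
  have e2 : ((ln r * M)%:E = \int[phi]_(u in U) (cst (ln r)%:E u))%E.
    rewrite EFinM -massE; exact/esym/(integral_cst phi mU).
  rewrite e1 e2 -ge0_integralD//; last 2 first.
  - by move=> u Uu; exact: (neg_log_support_ge0 hC Ce e_small nK').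
  - by move=> u _; rewrite mule_ge0// lee_fin.
  rewrite -ge0_integralD//; last by move=> u Uu; exact: (neg_log_support_ge0 hC Ce e_small nK).
  apply: ge0_le_integral => //.
  - move=> u Uu; apply: adde_ge0; first exact: (neg_log_support_ge0 hC Ce e_small nK').
    by rewrite mule_ge0// lee_fin.
  - exact: emeasurable_funD.
  - exact: emeasurable_funD.
have [a aE] : exists a : R, E K = a%:E.
  exists (fine (E K)); rewrite fineK// ge0_fin_numE//.
  exact: (support_energy_ge0 hC phi Ce e_small nK).
have [b bE] : exists b : R, E K' = b%:E.
  exists (fine (E K')); rewrite fineK// ge0_fin_numE.
    apply: le_lt_trans (ltry (a + ln r * M)); rewrite EFinD -aE.
    by apply: le_trans intI; rewrite leeDl// lee_fin mulr_ge0// fine_ge0.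
  exact: (support_energy_ge0 hC phi Ce e_small nK').
have := Kmin _ nK'; rewrite /objective aE bE VK' -!EFinD lee_fin.
move: intI; rewrite aE bE -!EFinD lee_fin.
have VW0 : 0 < V W := pow_int_gt0 n0 hC q0 psW.
have V0 : 0 < V K := pow_int_gt0 n0 hC q0 psK.
have M0 : 0 < M := mass_gt0 phiU.
by move=> h1 h2; exact: balance h1 h2.
Qed.

End optimality.

Section comparison.
Context {R : realType} {n : nat}.

(** The sets of points at distance at least [1 / (k + 1)] from the complement. *)
Lemma open_closed_exhaustion (O : set 'rV[R]_n) : open O ->
  exists F : nat -> set 'rV[R]_n, [/\ forall k, closed (F k), nondecreasing_seq F &
    \bigcup_k F k = O].
Proof.
move=> oO; exists (fun k => \bigcap_(y in ~` O) [set x | k.+1%:R^-1 <= `|x - y|]); split.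
- move=> k; apply: closed_bigI => y _.
  rewrite (_ : mkset _ = (fun x => `|x - y|) @^-1` [set r | k.+1%:R^-1 <= r])//.
  apply: closed_comp => [x _|]; last exact: closed_ge.
  exact: (cvg_norm (cvgB (@cvg_id _ (nbhs x)) (cvg_cst y))).
- move=> k l kl; apply/subsetPset => x hx y Oy /=; apply: le_trans (hx _ Oy).
  by rewrite lef_pV2 ?posrE// ler_nat.
- apply/seteqP; split => [x [k _ hx]|x Ox].
    apply: contrapT => nOx; have := hx _ nOx; rewrite /= subrr normr0 leNgt invr_gt0.
    by rewrite ltr0n.
  have : nbhs x O by exact: open_nbhs_nbhs.
  move=> /nbhs_ballP[d /= d0 dO].
  have [k _ /(_ k (leqnn k)) kd] := near_infty_natSinv_lt (PosNum d0).
  exists k => // y nOy /=; rewrite leNgt; apply/negP => h; apply: nOy; apply: dO.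
  by rewrite -ball_normE /ball_/=; exact: lt_trans kd.
Qed.

(** Inequality on closed sets passes to open sets by exhaustion and, since the total masses agree,
    to the reverse inequality by taking complements. *)
Lemma measure_eq_of_closed_le (m1 m2 : {measure set (borel R n) -> \bar R}) :
  (m2 setT < +oo)%E -> (m2 setT <= m1 setT)%E ->
  (forall F : set 'rV[R]_n, closed F -> (m1 F <= m2 F)%E) ->
  forall A : set (borel R n), measurable A -> m1 A = m2 A.
Proof.
move=> fin2 tot le12.
have totE : m1 setT = m2 setT.
  by apply/eqP; rewrite eq_le tot andbT; apply: le12; exact: closedT.
have fin1 : (m1 setT < +oo)%E by rewrite totE.
have leO (O : set 'rV[R]_n) : open O -> (m1 O <= m2 O)%E.
  move=> oO; have [F [cF nF FO]] := open_closed_exhaustion oO.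
  have mF k : measurable (F k : set (borel R n)) by exact: closed_borel.
  have mO : measurable (\bigcup_k F k : set (borel R n)) by exact: bigcupT_measurable.
  have c1 := nondecreasing_cvg_mu (mu := m1) mF mO nF.
  have c2 := nondecreasing_cvg_mu (mu := m2) mF mO nF.
  rewrite -FO -(cvg_lim _ c1)// -(cvg_lim _ c2)//; apply: lee_lim.
  - by apply/cvg_ex; eexists; exact: c1.
  - by apply/cvg_ex; eexists; exact: c2.
  - by apply: nearW => k; exact: le12.
have leOr (O : set 'rV[R]_n) : open O -> (m2 O <= m1 O)%E.
  move=> oO; have mO : measurable (O : set (borel R n)) by exact: open_borel.
  have mOc : measurable (~` O : set (borel R n)) by exact: measurableC.
  have split_m (m : {measure set (borel R n) -> \bar R}) : (m setT = m O + m (~` O))%E.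
    rewrite -measureU//; first by rewrite setUv.
    by rewrite setICr.
  have fin (m : {measure set (borel R n) -> \bar R}) (A : set (borel R n)) :
      (m setT < +oo)%E -> measurable A -> m A \is a fin_num.
    move=> mT mA; rewrite ge0_fin_numE//; apply: le_lt_trans mT.
    by apply: le_measure; rewrite ?inE.
  have le12c : (m1 (~` O) <= m2 (~` O))%E by apply: le12; rewrite closedC.
  rewrite -(@leeD2rE _ (m2 (~` O)))//; last exact: fin.
  by rewrite -split_m -totE (split_m m1); exact: leeD.
move=> A mA; apply: (@measure_unique _ R (borel R n) (@open 'rV[R]_n) (fun=> setT)) => //.
- exact: openI.
- by move=> _; exact: openT.
- by rewrite bigcup_const.
- by move=> O oO; apply/eqP; rewrite eq_le leO// leOr.
Qed.

End comparison.

(** * The radial Gauss map and the dual curvature measure *)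

Section curvature.
Context {R : realType} {n : nat}.
Implicit Types (u x y z v : 'rV[R]_n) (K F : set 'rV[R]_n).
Variables (C : set 'rV[R]_n).
Hypothesis hC : pointed_cone C.
Variable q : R.
Hypothesis q0 : q < 0.
Local Notation sigma := (@sphere_measure R n).
Local Notation Om := (Omega C : set (borel R n)).
Local Notation U := (cl_Omega_dual C : set (borel R n)).
Local Notation V := (pow_int C q).

Lemma normals_at_direction_scale K (t : R) v : ps C K -> nbhs v C -> 0 < t ->
  normals_at_direction [set x | K (t^-1 *: x)] v = normals_at_direction K v.
Proof.
move=> psK Cv t0; rewrite /normals_at_direction (radial_scale hC psK Cv t0) -scalerA.
apply/seteqP; split => u [su hu]; split => // y Ky.
  have Kty : [set x | K (t^-1 *: x)] (t *: y).
    by rewrite /= scalerA mulVf ?gt_eqF// scale1r.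
  by have := hu _ Kty; rewrite -scalerBr dotZl pmulr_rle0.
have := hu _ Ky; rewrite -(pmulr_rle0 _ t0) -dotZl scalerBr.
by rewrite (scalerA t t^-1) mulfV ?gt_eqF// scale1r.
Qed.

Section regular.
Variable K : set 'rV[R]_n.
Hypothesis psK : ps C K.
Variable nu : {measure set (borel R n) -> \bar R}.
Hypothesis nuE : forall A, nu A = (\int[sigma]_(v in Om `&` A) (radial K v `^ q)%:E)%E.

Definition has_normal_in F : set (borel R n) :=
  [set v | Om v /\ exists2 u, normals_at_direction K v u & F u].

(** Directions with a normal vector in [cl_Omega_dual C] and without a kink, so that this normal vector is
    the only one. Unlike the complement of [eta C K], this set is measurable by construction. *)
Definition regular_directions : set (borel R n) :=
  has_normal_in U `\` \bigcup_(i in [set: 'I_n]) kinks C K i.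

Lemma measurable_regular : measurable regular_directions.
Proof.
apply: measurableD.
  by apply: measurable_normals_in => //; exact: closed_cl_Omega_dual.
by apply: fin_bigcup_measurable => // i _; exact: measurable_kinks.
Qed.

Lemma regular_unique v u u' : regular_directions v ->
  normals_at_direction K v u -> normals_at_direction K v u' -> u = u'.
Proof.
move=> [[Ov _] nk] uv u'v; apply: (unique_normal_outside_kinks hC psK Ov uv u'v).
by move=> i ki; apply: nk; exists i.
Qed.

Lemma regular_gauss v u : regular_directions v -> normals_at_direction K v u ->
  radial_gauss K v = u.
Proof.
move=> rv uv; rewrite /radial_gauss; case: xgetP => [w _ wv|/(_ u)//].
exact: (regular_unique rv).
Qed.

Lemma regular_gauss_normal v : regular_directions v ->
  normals_at_direction K v (radial_gauss K v).
Proof.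
by move=> rv; have [[_ [u uv _]] _] := rv; rewrite (regular_gauss rv uv).
Qed.

(** A unique normal vector excludes kinks, each of which involves two distinct normal vectors. *)
Lemma regular_preimage (w : set 'rV[R]_n) : w `<=` cl_Omega_dual C ->
  radial_gauss_preimage C K w = regular_directions `&` radial_gauss K @^-1` w.
Proof.
move=> wU; apply/seteqP; split => v.
  move=> [[Ov ne] wv]; split => //.
  have ex1 : exists! u, normals_at_direction K v u.
    by apply: contrapT => h; apply: ne.
  have [u [uv uu]] := ex1.
  have gv : radial_gauss K v = u.
    rewrite /radial_gauss; case: xgetP => [u' _ u'v|/(_ u)//]; exact/esym/uu.
  split; first by split => //; exists u => //; apply: wU; rewrite -gv.
  move=> [i _ [_ [a [b [av bv]]]]]; rewrite -(uu _ av) -(uu _ bv).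
  by rewrite ltxx.
move=> [rv wv]; split => //; split; first exact: rv.1.1.
move=> [_]; apply; exists (radial_gauss K v); split; first exact: regular_gauss_normal.
by move=> u uv; exact: regular_gauss.
Qed.

(** An image measure requires a function defined everywhere; the value 0 is only taken
    outside [regular_directions]. *)
Definition gauss_total (v : borel R n) : borel R n :=
  if v \in regular_directions then radial_gauss K v else 0.

Lemma measurable_gauss_total : measurable_fun setT gauss_total.
Proof.
have mD := measurable_regular.
have mcl F : closed F -> measurable (gauss_total @^-1` F).
  move=> cF.
  have E : gauss_total @^-1` F = (regular_directions `&` has_normal_in F) `|`
      (~` regular_directions `&` [set v | F 0]).
    apply/seteqP; split => v; rewrite /gauss_total /=.
      have [rv|nrv] := pselect (regular_directions v).
        rewrite mem_set// => Fv; left; split => //; split; first exact: rv.1.1.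
        by exists (radial_gauss K v) => //; exact: regular_gauss_normal.
      by rewrite memNset// => F0; right.
    move=> [[rv [_ [u uv Fu]]]|[nrv F0]].
      by rewrite mem_set// (regular_gauss rv uv).
    by rewrite memNset.
  rewrite E; apply: measurableU; apply: measurableI => //.
  - exact: measurable_normals_in.
  - exact: measurableC.
  - have [F0|F0] := pselect (F 0).
      by rewrite (_ : mkset _ = setT)//; apply/seteqP; split.
    by rewrite (_ : mkset _ = set0)//; apply/seteqP; split.
apply: (@measurability _ _ _ (borel R n) _ _ (@open 'rV[R]_n)) => // _ [G oG <-].
rewrite setTI -(setCK (gauss_total @^-1` G)); apply: measurableC.
by apply: (mcl (~` G)); rewrite closedC.
Qed.

Lemma gauss_total_preimage w : regular_directions `&` gauss_total @^-1` w =
  regular_directions `&` radial_gauss K @^-1` w.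
Proof.
by apply/seteqP; split => v [rv wv]; split => //; move: wv; rewrite /gauss_total /= mem_set.
Qed.

Lemma measurable_gauss_preimage (w : set (borel R n)) : measurable w ->
  measurable (regular_directions `&` gauss_total @^-1` w).
Proof.
move=> mw; apply: measurableI; first exact: measurable_regular.
by rewrite -[X in measurable X]setTI; exact: measurable_gauss_total.
Qed.

(** The directions with a normal vector in [F] that are not regular have a kink, and kinks are null. *)
Lemma regular_full F : closed F -> F `<=` U ->
  (nu (has_normal_in F) <= nu (regular_directions `&` gauss_total @^-1` F))%E.
Proof.
move=> cF FU.
have mk : measurable (\bigcup_(i in [set: 'I_n]) kinks C K i : set (borel R n)).
  by apply: fin_bigcup_measurable => // i _; exact: measurable_kinks.
have nk i : nu (kinks C K i : set (borel R n)) = 0%E.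
  rewrite nuE setIidr; last by move=> v [].
  apply: null_set_integral; [exact: measurable_kinks| |exact: kinks_null].
  by apply: measurable_funS (measurable_radial_pow hC q psK); [exact: measurable_Omega|move=> v []].
have nuk : nu (\bigcup_(i in [set: 'I_n]) kinks C K i : set (borel R n)) = 0%E.
  apply/eqP; rewrite -measure_le0.
  apply: (le_trans (@content_sub_fsum _ _ _ nu _ [set: 'I_n] _ (kinks C K) _ _ mk _)) => //.
  - exact: finite_finset.
  - by move=> i _; exact: measurable_kinks.
  - by rewrite fsbig1// => i _; exact: nk.
rewrite -[leRHS]adde0 -nuk.
have mA : measurable (regular_directions `&` gauss_total @^-1` F).
  by apply: measurable_gauss_preimage; exact: closed_borel.
apply: le_trans (measureU2 nu mA mk); apply: le_measure; rewrite ?inE.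
- exact: measurable_normals_in.
- exact: measurableU.
move=> v [Ov [u uv Fu]].
have [kv|nkv] := pselect ((\bigcup_(i in [set: 'I_n]) kinks C K i) v); [by right|left].
have rv : regular_directions v.
  by split => //; split => //; exists u => //; exact: FU.
by split => //=; rewrite /gauss_total mem_set// (regular_gauss rv uv).
Qed.

(** Once every closed set carries at least its share of the measure, equality of the total masses
    turns the inequalities into the identity of measures. *)
Lemma curvature_eq (phi : {finite_measure set (borel R n) -> \bar R}) :
  phi (~` U) = 0%E -> phi U <> 0%E ->
  (forall F : set 'rV[R]_n, closed F -> F `<=` U ->
    ((fine (phi F) / mass C phi * V K)%:E <= nu (has_normal_in F))%E) ->
  forall w : set 'rV[R]_n, w `<=` cl_Omega_dual C -> measurable (w : set (borel R n)) ->
    dual_curvature C q K w = ((n%:R^-1 * (V K / mass C phi))%:E * phi w)%E.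
Proof.
move=> phi0 phiU hF w wU mw.
have M0 := mass_gt0 phiU; have mU := measurable_U C.
have c0 : 0 <= V K / mass C phi by rewrite divr_ge0 ?pow_int_ge0// ltW.
have mD := measurable_regular.
pose m1 : {measure set (borel R n) -> \bar R} := mscale (NngNum c0) phi.
pose m2 : {measure set (borel R n) -> \bar R} :=
  measure_function_pushforward__canonical__measure_function_Measure
    (mrestr nu mD) measurable_gauss_total.
have m1E A : m1 A = ((V K / mass C phi)%:E * phi A)%E by [].
have m2E A : m2 A = nu (regular_directions `&` gauss_total @^-1` A).
  by rewrite setIC.
have phiE A : measurable A -> phi A = phi (A `&` U).
  move=> mA; rewrite (measureDI phi mA mU) -[RHS]add0e; congr (_ + _)%E.
  apply/eqP; rewrite -measure_le0 -phi0; apply: le_measure; rewrite ?inE//.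
  - exact: measurableD.
  - exact: measurableC.
have nuOm : nu Om = (V K)%:E by rewrite nuE setIid; exact: (pow_intE hC q0 psK).
have le12 F : closed F -> (m1 F <= m2 F)%E.
  move=> cF; have mF : measurable (F : set (borel R n)) by exact: closed_borel.
  have cFU : closed (F `&` cl_Omega_dual C) by apply: closedI => //; exact: closed_cl_Omega_dual.
  have FU : F `&` cl_Omega_dual C `<=` U by move=> x [].
  have mFU : measurable (F `&` U : set (borel R n)) by exact: measurableI.
  rewrite m1E m2E phiE//.
  apply: (@le_trans _ _ (nu (has_normal_in (F `&` cl_Omega_dual C)))).
    apply: le_trans (hF _ cFU FU).
    have -> : phi (F `&` U) = (fine (phi (F `&` U)))%:E by rewrite fineK// fin_num_measure.
    by rewrite -EFinM lee_fin mulrC mulrA mulrAC.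
  apply: le_trans (regular_full cFU FU) _; apply: le_measure; rewrite ?inE.
  - by apply: measurable_gauss_preimage; exact: closed_borel.
  - exact: measurable_gauss_preimage.
  - by move=> x [rx [Fx _]].
have m2T : (m2 setT <= (V K)%:E)%E.
  rewrite m2E preimage_setT setIT -nuOm; apply: le_measure; rewrite ?inE//.
    exact: measurable_Omega.
  by move=> v [[]].
have m1T : m1 setT = (V K)%:E.
  by rewrite m1E phiE// setTI massE -EFinM mulfVK// gt_eqF.
have m12 : m1 w = m2 w.
  apply: measure_eq_of_closed_le => //.
  - exact: le_lt_trans m2T (ltry _).
  - by rewrite m1T.
rewrite EFinM -muleA -m1E m12 m2E nuE /dual_curvature (regular_preimage wU).
congr (_ * _)%E.
have OR : Om `&` regular_directions = regular_directions by apply: setIidr => v [[]].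
by rewrite gauss_total_preimage setIA OR.
Qed.

End regular.

Lemma dual_curvature_scale K (t : R) (w : set 'rV[R]_n) : ps C K -> 0 < t ->
  w `<=` cl_Omega_dual C -> measurable (w : set (borel R n)) ->
  dual_curvature C q [set x | K (t^-1 *: x)] w = ((t `^ q)%:E * dual_curvature C q K w)%E.
Proof.
move=> psK t0 wU mw; set K' := [set x | _].
have nE v : Om v -> normals_at_direction K' v = normals_at_direction K v.
  by move=> Ov; apply: normals_at_direction_scale Ov.2 t0.
have gE v : Om v -> radial_gauss K' v = radial_gauss K v.
  by move=> Ov; rewrite /radial_gauss nE.
have pE : radial_gauss_preimage C K' w = radial_gauss_preimage C K w.
  have eE v : Om v -> eta C K' v = eta C K v by move=> Ov; rewrite /eta /= nE.
  apply/seteqP; split => v [[Ov ne] wv]; (split; first by split => //; move: ne; rewrite eE).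
    by move: wv; rewrite /= gE.
  by rewrite /= gE.
have PO : radial_gauss_preimage C K w `<=` Om by move=> v [[]].
have mP : measurable (radial_gauss_preimage C K w : set (borel R n)).
  rewrite (regular_preimage psK wU) -gauss_total_preimage.
  exact: measurable_gauss_preimage.
rewrite /dual_curvature pE muleCA; congr (_ * _)%E.
rewrite -ge0_integralZl//=; last 3 first.
- by apply: measurable_funS (measurable_radial_pow hC q psK) => //; exact: measurable_Omega.
- by move=> v _; rewrite lee_fin powR_ge0.
- by rewrite lee_fin powR_ge0.
apply: eq_integral => v; rewrite inE => /PO Ov; have rg := radial_gt0 hC psK Ov.2.
by rewrite (radial_scale hC psK Ov.2 t0) (powRM _ (ltW t0) (ltW rg)).
Qed.

End curvature.

Theorem theorem2 (R : realType) (n : nat) (n_ge2 : (2 <= n)%N)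
    (C : set 'rV[R]_n) (C_cone : pointed_cone C)
    (q : R) (q_lt0 : q < 0)
    (phi : {finite_measure set (borel R n) -> \bar R})
    (phi_supp : phi (~` cl_Omega_dual C) = 0%E)
    (phi_neq0 : phi (cl_Omega_dual C) <> 0%E) :
  exists2 K : set 'rV[R]_n, ps C K &
    forall w : set 'rV[R]_n, w `<=` cl_Omega_dual C ->
      measurable (w : set (borel R n)) -> dual_curvature C q K w = phi w.
Proof.
have n0 : (0 < n)%N by exact: ltnW.
have [_ _ _ [x Cx] _] := C_cone.
(* dividing [x] by a bound for [- dot u x] makes the energy nonnegative *)
pose b := n%:R * `|x| + 1.
have b0 : 0 < b by rewrite ltr_wpDl// mulr_ge0.
have Ce : nbhs (b^-1 *: x) C by apply: (int_coneZ C_cone) => //; rewrite invr_gt0.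
have e_small u : cl_Omega_dual C u -> - dot u (b^-1 *: x) <= 1.
  move=> /cl_Omega_dual_sub[su _]; rewrite dotZr -mulrN ler_pdivrMl// mulr1.
  apply: le_trans (ler_norm _) _; rewrite normrN.
  apply: le_trans (norm_dot_le _ _) _; apply: (@le_trans _ _ (n%:R * `|x|)); last by rewrite lerDl.
  by apply: ler_wpM2l => //; apply: ler_piMl => //; exact: sphere_norm_le1.
have [K nK [Efin Kmin]] := minimizer_exists n0 C_cone q_lt0 Ce e_small phi_neq0.
have [psK _] := nK.
have [nu nuE] := density_measure (@sphere_measure R n) (measurable_Omega C) (measurable_radial_pow C_cone q psK)
  (fun v _ => (powR_ge0 (radial K v) q : (0 <= (radial K v `^ q)%:E)%E)).
have M0 := mass_gt0 phi_neq0.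
have mU := measurable_U C.
have share (F : set 'rV[R]_n) : closed F -> F `<=` cl_Omega_dual C ->
    ((fine (phi F) / mass C phi * pow_int C q K)%:E <= nu (has_normal_in C K F))%E.
  move=> cF FU; have mF : measurable (F : set (borel R n)) by exact: closed_borel.
  apply: (nu_normals C_cone q_lt0 psK cF) nuE.
  - by move=> u /FU /cl_Omega_dual_sub.
  - rewrite divr_ge0 ?fine_ge0 ?(ltW M0)//= ler_pdivrMr// mul1r.
    apply: fine_le; rewrite ?fin_num_measure//.
    by apply: le_measure; rewrite ?inE.
  - by move=> lam l1; exact: (minimizer_wulff n0 C_cone q_lt0 Ce e_small phi_neq0).
have V0 : 0 < pow_int C q K := pow_int_gt0 n0 C_cone q_lt0 psK.
(* the curvature measure of the minimizer is [c] times [phi]; the dilation by [t] multiplies it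
   by [t ^ q = 1 / c] *)
pose c := n%:R^-1 * (pow_int C q K / mass C phi).
have c0 : 0 < c by rewrite mulr_gt0 ?divr_gt0// invr_gt0 ltr0n.
pose t := c `^ (- q^-1).
have t0 : 0 < t by exact: powR_gt0.
exists [set y | K (t^-1 *: y)]; first exact: (ps_scale C_cone psK t0).
move=> w wU mw.
rewrite (dual_curvature_scale C_cone q psK t0 wU mw).
rewrite (curvature_eq C_cone q_lt0 psK nuE phi_supp phi_neq0 share wU mw) -/c.
rewrite muleA -EFinM -powRrM mulNr mulVf ?lt_eqF//.
by rewrite powR_inv1 ?ltW// mulVf ?gt_eqF// mul1e.
Qed.
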